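(* There exists an $8$-approximation algorithm for the special case of the PartialResAll problem in which the input set of jobs forms a single mountain.
   Context: PartialResAll problem. Time is discretized into timeslots $1,2,\dots,T$. The input consists of a set $\mathcal{J}$ of jobs, a set $\mathcal{I}$ of resources, and an integer $k$ (the partiality parameter). Each job $j$ is an interval $[s(j),e(j)]$ with integers $1\le s(j)\le e(j)\le T$, and has demand $1$. Each resource $i$ is an interval $[s(i),e(i)]\subseteq[1,T]$ with an integer capacity $w(i)$ and a cost $c(i)$. A job/resource is active at $t$ if $t$ lies in its interval. For a set $J$ of jobs, $P_J(t)$ is the number of jobs of $J$ active at $t$; for a multiset $R$ of resources, $P_R(t)=\sum_{i\in R \text{ active at } t} w(i)$ (with multiplicity). $R$ covers $J$ if $P_R(t)\ge P_J(t)$ for all $t$. The cost of $R$ is the sum of the costs of its elements with multiplicity (multiple copies of a resource may be taken, each paid for). A feasible solution is a pair $(R,J)$ with $J\subseteq\mathcal{J}$, $|J|\ge k$ and $R$ covering $J$; the objective is to minimize the cost of $R$. A set $M$ of jobs is a mountain if there is a timeslot $t$ at which all jobs of $M$ are active. An approximation algorithm is understood to run in polynomial time and to output a feasible solution of cost at most the stated factor times the optimum. *)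

(* Defs.v *)
From HB Require Import structures.
From mathcomp Require Import all_boot all_order all_algebra.

Set Implicit Arguments.
Unset Strict Implicit.
Unset Printing Implicit Defensive.

Import Order.TTheory GRing.Theory Num.Theory.

Local Open Scope ring_scope.

(** * The problem PartialResAll *)

(* Costs are nonnegative: since copies are unlimited, a usable resource of
   negative cost would leave the optimum unbounded below.  They are rational so
   that an instance is a finite input.  Capacities and [partiality] are
   arbitrary integers. *)
Record instance := Instance {
  horizon : nat;
  partiality : int;
  njobs : nat;
  job_start : 'I_njobs -> nat;
  job_end : 'I_njobs -> nat;
  nresources : nat;
  res_start : 'I_nresources -> nat;
  res_end : 'I_nresources -> nat;
  capacity : 'I_nresources -> int;
  res_cost : 'I_nresources -> rat;
  job_wf : forall j, (1 <= job_start j <= job_end j)%N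
                  /\ (job_end j <= horizon)%N;
  res_wf : forall i, (1 <= res_start i <= res_end i)%N
                  /\ (res_end i <= horizon)%N;
  res_cost_ge0 : forall i, 0 <= res_cost i
}.

Definition timeslot (I : instance) (t : nat) : bool := (1 <= t <= horizon I)%N.

Definition job_active (I : instance) (j : 'I_(njobs I)) (t : nat) : bool :=
  (job_start j <= t <= job_end j)%N.

Definition res_active (I : instance) (i : 'I_(nresources I)) (t : nat) : bool :=
  (res_start i <= t <= res_end i)%N.

(* A multiset of resources is its multiplicity function. *)
Definition resource_multiset (I : instance) := {ffun 'I_(nresources I) -> nat}.

Definition job_profile (I : instance) (J : {set 'I_(njobs I)}) (t : nat) : nat :=
  #|[set j in J | job_active j t]|.

Definition res_profile (I : instance) (R : resource_multiset I) (t : nat) : int :=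
  \sum_(i | res_active i t) capacity i *+ R i.

Definition covers (I : instance) (R : resource_multiset I)
    (J : {set 'I_(njobs I)}) : Prop :=
  forall t, timeslot I t -> (job_profile J t)%:Z <= res_profile R t.

Definition multiset_cost (I : instance) (R : resource_multiset I) : rat :=
  \sum_i res_cost i *+ R i.

Definition feasible (I : instance) (R : resource_multiset I)
    (J : {set 'I_(njobs I)}) : Prop :=
  partiality I <= #|J|%:Z /\ covers R J.

Definition mountain (I : instance) (M : {set 'I_(njobs I)}) : Prop :=
  exists2 t, timeslot I t & forall j, j \in M -> job_active j t.

Definition single_mountain (I : instance) : Prop :=
  mountain [set: 'I_(njobs I)].

(** * Polynomial time

   The machine is a random access machine with integer cells, indirect
   addressing, addition, subtraction and halving, at unit cost.  Multiplication
   is deliberately not primitive: without it a run of n steps creates only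
   integers of O(n) bits more than the input, and unit-cost running time is
   polynomially related to Turing machine time (Papadimitriou, Computational
   Complexity, Section 2.6).  Structured control flow replaces jumps. *)

Inductive expr :=
  | Const of int
  | Read of expr
  | Add of expr & expr
  | Sub of expr & expr
  | Half of expr.

Inductive cmd :=
  | Skip
  | Write of expr & expr
  | Seq of cmd & cmd
  | IfPos of expr & cmd & cmd
  | WhilePos of expr & cmd.

Definition memory := int -> int.

Definition update (m : memory) (a v : int) : memory :=
  fun b => if b == a then v else m b.

Fixpoint eval (m : memory) (e : expr) : int :=
  match e with
  | Const z => z
  | Read e1 => m (eval m e1)
  | Add e1 e2 => eval m e1 + eval m e2
  | Sub e1 e2 => eval m e1 - eval m e2
  | Half e1 => (eval m e1 %/ 2)%Z
  end.

(* [exec c m m' n]: from memory [m], the command [c] halts with memory [m'],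
   having performed [n] assignments, skips and tests.  Expressions are not
   charged separately: their sizes are bounded by a constant of the program. *)
Inductive exec : cmd -> memory -> memory -> nat -> Prop :=
  | ExecSkip m : exec Skip m m 1
  | ExecWrite a e m : exec (Write a e) m (update m (eval m a) (eval m e)) 1
  | ExecSeq c1 c2 m m1 m2 n1 n2 :
      exec c1 m m1 n1 -> exec c2 m1 m2 n2 -> exec (Seq c1 c2) m m2 (n1 + n2)
  | ExecIfTrue e c1 c2 m m1 n :
      0 < eval m e -> exec c1 m m1 n -> exec (IfPos e c1 c2) m m1 n.+1
  | ExecIfFalse e c1 c2 m m1 n :
      eval m e <= 0 -> exec c2 m m1 n -> exec (IfPos e c1 c2) m m1 n.+1
  | ExecWhileTrue e c m m1 m2 n1 n2 :
      0 < eval m e -> exec c m m1 n1 -> exec (WhilePos e c) m1 m2 n2 ->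
      exec (WhilePos e c) m m2 (n1 + n2).+1
  | ExecWhileFalse e c m :
      eval m e <= 0 -> exec (WhilePos e c) m m 1.

Definition encode (I : instance) : seq int :=
  [:: (horizon I)%:Z; partiality I; (njobs I)%:Z; (nresources I)%:Z]
  ++ flatten [seq [:: (job_start j)%:Z; (job_end j)%:Z] | j : 'I_(njobs I)]
  ++ flatten [seq [:: (res_start i)%:Z; (res_end i)%:Z; capacity i;
                      numq (res_cost i); denq (res_cost i)]
             | i : 'I_(nresources I)].

Definition bit_length (z : int) : nat := (trunc_log 2 `|z|%N).+1.

Definition input_size (I : instance) : nat :=
  (\sum_(z <- encode I) bit_length z)%N.

(* The input occupies the addresses 0, 1, 2, ...; all other cells, including
   those at negative addresses, are 0 and available as work space. *)
Definition initial_memory (I : instance) : memory :=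
  fun a => if a is Posz p then nth 0 (encode I) p else 0.

(* The output is the indicator vector of the selected jobs, from address 0,
   followed by the vector of the multiplicities of the resources. *)
Definition outputs (I : instance) (m : memory) (R : resource_multiset I)
    (J : {set 'I_(njobs I)}) : Prop :=
  (forall j : 'I_(njobs I), m (val j)%:Z = (j \in J)%:Z)
  /\ (forall i : 'I_(nresources I), m (njobs I + val i)%N%:Z = (R i)%:Z).

Definition polynomial_time (P : instance -> Prop) (prog : cmd) : Prop :=
  exists c d : nat, forall I : instance, P I ->
    exists (m : memory) (n : nat),
      exec prog (initial_memory I) m n /\ (n <= c * input_size I ^ d)%N.

(* Nothing is required of the output on instances without feasible solution. *)
Definition computes_approximation (P : instance -> Prop) (rho : rat)
    (prog : cmd) : Prop :=
  forall I : instance, P I ->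
    (exists (R : resource_multiset I) (J : {set 'I_(njobs I)}), feasible R J) ->
    exists (m : memory) (n : nat) (R : resource_multiset I)
           (J : {set 'I_(njobs I)}),
      [/\ exec prog (initial_memory I) m n, outputs m R J, feasible R J
        & forall (R' : resource_multiset I) (J' : {set 'I_(njobs I)}),
            feasible R' J' -> multiset_cost R <= rho * multiset_cost R'].

Definition approximation_algorithm (P : instance -> Prop) (rho : rat)
    (prog : cmd) : Prop :=
  polynomial_time P prog /\ computes_approximation P rho prog.

(* Main.v *)
(** Let [t0] be a timeslot at which all jobs are active and scan outwards from it.
    While fewer than [k] jobs lie strictly between the current ends [l <= t0 <= r],
    let [g] be the number of missing jobs. Every feasible solution executes at
    least [g] jobs that reach [l] or [r], so its resources have total capacity at
    least [g] there, even after truncating capacities at [g]. Local ratio: decrease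
    the cost of each resource proportionally to its truncated capacity at [l] and
    [r] until some resource becomes free, and push [l] and [r] out to the ends of
    that resource. Multiples of free resources can be taken at will, so the jobs
    inside [(l, r)] may be chosen, [k] in total.

    At the end, take as many copies of every free resource as there are chosen
    jobs, and delete copies in reverse order as long as the chosen jobs stay
    covered. A resource that keeps a copy has a critical time, at which no resource
    freed earlier is active and at which one copy less would not suffice. Hence at
    a stage with ends [l], [r] and gap [g], the remaining resources active at [l]
    have truncated capacity at most [2 g] on either side of [l], and the same holds
    at [r]. So every stage is paid at most [8 g] while the optimum pays [g]. *)

From mathcomp Require Import all_boot all_order all_algebra.
From mathcomp Require Import zify ring.
From Stdlib Require Import FunctionalExtensionality.
Require Import Defs.

Set Implicit Arguments.
Unset Strict Implicit.
Unset Printing Implicit Defensive.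

Import Order.TTheory GRing.Theory Num.Theory.

Local Open Scope ring_scope.

(** * Local ratio and reverse delete *)

(** The factor 8 is 2 * 2 * 2: two ends, two sides of each end, and [2 * g] per side. On one side of
    [l], every remaining resource active at [l] contains the critical time closest to [l]. That time
    avoids the resources freed before the stage, so it lies outside the interval they cover, and at
    most [g] chosen jobs are active there. Removing one copy leaves a load below [g], and truncation
    values that copy at no more than [g]; an untruncated copy could be arbitrarily large. Reverse
    order makes critical times avoid earlier resources: those still have all their copies, and any
    one of them alone would cover the chosen jobs. Two obstacles shape the program. The machine has
    neither multiplication nor general division, so residual costs are kept as integers over a scale
    that grows with every stage; they become long numbers, but in each product the other factor is
    short. And the horizon may be exponential in the input size, so coverage is tested only at
    breakpoints. *)

Lemma intmulnE (x : int) n : x *+ n = x * n%:Z.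
Proof. by rewrite -mulr_natr natz. Qed.

Section LocalRatio.

Variable I : instance.

Implicit Types (i : 'I_(nresources I)) (j : 'I_(njobs I)).
Implicit Types (R : resource_multiset I) (J : {set 'I_(njobs I)}).
Implicit Types (ord : seq 'I_(nresources I)).

Lemma profile_outside R J t : ~~ timeslot I t ->
  job_profile J t = 0%N /\ res_profile R t = 0.
Proof.
move=> ht; split.
- apply/eqP; rewrite cards_eq0 -subset0; apply/subsetP => j; rewrite !inE.
  case/andP => _; rewrite /job_active; move: ht (job_wf j); rewrite /timeslot; lia.
- rewrite /res_profile big1 // => i; rewrite /res_active.
  move: ht (res_wf i); rewrite /timeslot; lia.
Qed.

(** The ends of the scan may step to [0] or past the horizon, so coverage is also needed at times
    that are not timeslots, where both profiles vanish. *)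
Lemma covers_all R J : covers R J ->
  forall t, (job_profile J t)%:Z <= res_profile R t.
Proof.
move=> hc t; case: (boolP (timeslot I t)) => ht; first exact: hc.
by have [-> ->] := profile_outside R J ht.
Qed.

(** * Lower bound of a stage: the weight of every feasible solution *)

Definition inside (l r : nat) : {set 'I_(njobs I)} :=
  [set j | (l < job_start j)%N && (job_end j < r)%N].

(* Capacities are truncated at the number [g] of jobs still to be covered. *)
Definition unit_weight (g : int) i : int :=
  if 0 < capacity i then Num.min (capacity i) g else 0.

(** A resource active at both ends counts twice, also when [l = r]; this makes the weight of a
    multiset the sum of its truncated loads at [l] and at [r]. *)
Definition weight (l r : nat) (g : int) i : int :=
  unit_weight g i * (res_active i l)%:Z + unit_weight g i * (res_active i r)%:Z.

Lemma unit_weight_ge0 g i : 0 <= g -> 0 <= unit_weight g i.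
Proof. by move=> hg; rewrite /unit_weight; case: ifP => // /ltW h; rewrite le_min h hg. Qed.

Lemma weight_ge0 l r g i : 0 <= g -> 0 <= weight l r g i.
Proof. by move=> hg; rewrite addr_ge0 // mulr_ge0 // unit_weight_ge0. Qed.

(** A job that contains [t0] but does not lie strictly between [l] and [r] contains [l] or [r], so
    the jobs that [inside] cannot supply load the two ends. *)
Lemma weight_lower_bound R J l r g t0 :
  (forall j, (job_start j <= t0 <= job_end j)%N) -> (l <= t0 <= r)%N -> 0 < g ->
  #|inside l r|%:Z + g <= partiality I -> feasible R J ->
  g <= \sum_i weight l r g i *+ R i.
Proof.
move=> peak hlr g0 hin [hk /covers_all hcov].
have hout : g <= #|J :\: inside l r|%:Z.
  have := cardsID (inside l r) J.
  have : (#|J :&: inside l r| <= #|inside l r|)%N by rewrite subset_leq_card ?subsetIr.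
  lia.
have hsub : (#|J :\: inside l r| <= job_profile J l + job_profile J r)%N.
  apply: leq_trans (leq_card_setU _ _).
  apply: subset_leq_card; apply/subsetP => j; rewrite !inE => /andP[hj ->] /=.
  by rewrite /job_active; move: hj (peak j); lia.
have hload : g <= res_profile R l + res_profile R r.
  by move: (hcov l) (hcov r); lia.
(* Either a used resource active at an end has capacity at least [g], and one copy of it already
   weighs [g], or truncation lowers no term of the two loads. *)
case: (boolP [exists i, [&& (0 < R i)%N, g <= capacity i & res_active i l || res_active i r]]).
- case/existsP => i /and3P[hR hcap hact].
  rewrite (bigD1 i) //=; apply: (@le_trans _ _ (weight l r g i *+ R i)); last first.
    by rewrite lerDl sumr_ge0 // => i' _; rewrite mulrn_wge0 // weight_ge0 // ltW.
  have hw : g <= weight l r g i.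
    rewrite /weight /unit_weight (lt_le_trans g0 hcap) (min_idPr hcap).
    by case: (res_active i l) hact; case: (res_active i r) => //= _; lia.
  by rewrite -[R i]prednK // mulrS; apply: le_trans hw _;
    rewrite lerDl mulrn_wge0 // weight_ge0 // ltW.
- rewrite negb_exists => /forallP hno.
  apply: le_trans hload _; rewrite /res_profile.
  rewrite big_mkcond [X in _ + X]big_mkcond -big_split /=.
  apply: ler_sum => i _; rewrite !intmulnE /weight /unit_weight mulrDl.
  have := hno i.
  case: (posnP (R i)) => [-> _|hR]; first by rewrite !mulr0; case: ifP; case: ifP.
  have hR0 : 0 <= (R i)%:Z by [].
  case: (ltrP 0 (capacity i)) => hc /=; last first.
    by rewrite !mul0r addr0; case: ifP; case: ifP => _ _; nia.
  case: (lerP g (capacity i)) => //= hg.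
    by rewrite negb_or => /andP[/negbTE -> /negbTE ->]; rewrite !mulr0 mul0r.
  move=> _; case: ifP; case: ifP => _ _ /=; rewrite ?mulr1 ?mulr0 ?mul0r //; lia.
Qed.

(** * Upper bound of a stage: truncated load at one end *)

Definition unit_cost (g : int) R t : int :=
  \sum_(i | res_active i t) unit_weight g i *+ R i.

Lemma weight_unit_cost l r g R :
  \sum_i weight l r g i *+ R i = unit_cost g R l + unit_cost g R r.
Proof.
rewrite /unit_cost [X in _ = X + _]big_mkcond [X in _ = _ + X]big_mkcond -big_split /=.
apply: eq_bigr => i _; rewrite /weight mulrnDl.
by congr (_ + _); case: ifP => _; rewrite ?mulr1 // mulr0 mul0rn.
Qed.

(* A set of resources sharing the critical time of one of them has little
   weight: without one copy of that resource, the load there is below [g]. *)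
Lemma critical_bound g R (B : {set 'I_(nresources I)}) i0 t0 : 0 < g ->
  (forall i, (0 < R i)%N -> 0 < capacity i) ->
  i0 \in B -> (0 < R i0)%N -> (forall i, i \in B -> res_active i t0) ->
  res_profile R t0 - capacity i0 < g ->
  \sum_(i in B) unit_weight g i *+ R i <= 2 * g.
Proof.
move=> g0 hpos hi0 hR0 hact hcrit.
have hterm i : unit_weight g i *+ R i <= capacity i *+ R i.
  case: (posnP (R i)) => [->|hR]; first by rewrite !mulr0n.
  by rewrite lerMn2r /unit_weight (hpos _ hR) ge_min lexx orbT.
have hcap0 i : 0 <= capacity i *+ R i.
  case: (posnP (R i)) => [->|hR]; first by rewrite !mulr0n.
  by rewrite mulrn_wge0 // ltW // hpos.
(* One copy of [i0] is valued at [g] by truncation and the others at their capacity, so [B] weighs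
   at most [g] plus the load without that copy, which is below [g]. *)
have h0 : unit_weight g i0 *+ R i0 <= g + (capacity i0 *+ R i0 - capacity i0).
  rewrite -[R i0]prednK // !mulrS addrAC subrr add0r lerD //.
  - by rewrite /unit_weight hpos // ge_min lexx orbT.
  - by rewrite lerMn2r /unit_weight hpos // ge_min lexx !orbT.
have hB : \sum_(i in B) capacity i *+ R i <= res_profile R t0.
  rewrite /res_profile [X in _ <= X](bigID (fun i => i \in B)) /=.
  rewrite [X in _ <= X + _](eq_bigl (fun i => i \in B)); last first.
    by move=> i; case: (boolP (i \in B)) => hi; rewrite ?andbF // hact.
  by rewrite lerDl sumr_ge0.
rewrite (bigD1 i0) //= in hB; rewrite (bigD1 i0) //=.
have : \sum_(i in B | i != i0) unit_weight g i *+ R i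
   <= \sum_(i in B | i != i0) capacity i *+ R i by apply: ler_sum.
move: h0 hB hcrit; move: (\sum_(_ in _ | _) _) (\sum_(_ in _ | _) _) => X Y.
move: (unit_weight _ _ *+ _) (capacity i0 *+ _) (res_profile _ _) => u c P.
lia.
Qed.

(** The used resources active at [t] are split by the side of [t] on which their critical time [tau]
    lies. Each of them contains all times between [t] and its own [tau], so those on one side all
    contain the [tau] nearest to [t]. Each side then weighs at most [2 * g]. *)
Lemma unit_cost_bound g R t : 0 < g ->
  (forall i, (0 < R i)%N -> 0 < capacity i) ->
  (forall i, res_active i t -> (0 < R i)%N ->
     exists2 t0, res_active i t0 & res_profile R t0 - capacity i < g) ->
  unit_cost g R t <= 4 * g.
Proof.
move=> g0 hpos hcrit.
have /fin_all_exists[tau htau] : forall i, exists t0, res_active i t -> (0 < R i)%N ->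
    res_active i t0 /\ res_profile R t0 - capacity i < g.
  move=> i; case: (boolP (res_active i t && (0 < R i)%N)) => [/andP[h1 h2]|h].
    by have [t0 h3 h4] := hcrit i h1 h2; exists t0.
  by exists t => h1 h2; rewrite h1 h2 in h.
pose B := [set i | res_active i t && (0 < R i)%N].
pose B1 := [set i in B | (t <= tau i)%N]; pose B2 := [set i in B | (tau i < t)%N].
have half B' : B' = B1 \/ B' = B2 -> \sum_(i in B') unit_weight g i *+ R i <= 2 * g.
  move=> hB'; have [->|[i1 hi1]] := set_0Vmem B'; first by rewrite big_set0; lia.
  case: hB' => hB'; rewrite {}hB' in hi1 *.
  - case: (@arg_minnP _ i1 [in B1] tau hi1) => i0; rewrite !inE => /andP[/andP[ha hR] ht] hmin.
    have [h1 h2] := htau _ ha hR; apply: (@critical_bound _ _ _ i0 (tau i0)) => //.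
      by rewrite !inE ha hR ht.
    move=> i hi; move: (hmin i hi); move: hi; rewrite !inE => /andP[/andP[ha' hR'] ht'].
    have [h3 _] := htau _ ha' hR'; rewrite /res_active in ha ha' h1 h3 *; lia.
  - case: (@arg_maxnP _ i1 [in B2] tau hi1) => i0; rewrite !inE => /andP[/andP[ha hR] ht] hmin.
    have [h1 h2] := htau _ ha hR; apply: (@critical_bound _ _ _ i0 (tau i0)) => //.
      by rewrite !inE ha hR ht.
    move=> i hi; move: (hmin i hi); move: hi; rewrite !inE => /andP[/andP[ha' hR'] ht'].
    have [h3 _] := htau _ ha' hR'; rewrite /res_active in ha ha' h1 h3 *; lia.
have -> : unit_cost g R t = \sum_(i in B1) unit_weight g i *+ R i
                          + \sum_(i in B2) unit_weight g i *+ R i.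
  rewrite /unit_cost (bigID (fun i => i \in B1)) /=; congr (_ + _).
    by apply: eq_bigl => i; rewrite !inE; case: (res_active i t).
  rewrite (bigID (fun i => i \in B2)) /= [X in _ + X]big1 ?addr0; last first.
    move=> i; rewrite !inE; case: (res_active i t) => //=.
    by case: (posnP (R i)) => [->|_] /=; rewrite ?mulr0n //; case: ltnP.
  apply: eq_bigl => i; rewrite !inE; case: (res_active i t) => //=.
  by case: (0 < R i)%N; case: ltnP.
have := half B1 (or_introl erefl); have := half B2 (or_intror erefl); lia.
Qed.

(** * Stages, charges and the comparison with the optimum *)

(** Stages exist for the analysis only; the program does not store them. [dual] is the multiple of
    the stage weight that is subtracted from the original, unscaled costs. *)
Record stage := Stage {
  picked_before : seq 'I_(nresources I);
  left_end : nat;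
  right_end : nat;
  gap : int;
  dual : rat
}.

Implicit Types (s : stage) (ss : seq stage).

Definition stage_weight s i : int := weight (left_end s) (right_end s) (gap s) i.

(* The total amount subtracted from the cost of [i]. *)
Definition charge ss i : rat := \sum_(s <- ss) dual s * (stage_weight s i)%:~R.

(** [J] is the current choice, which may have grown since the stage. Counting the jobs still missing
    in [outside_gap] makes it stable under such growth; once none is missing, it bounds the chosen
    jobs outside the interval of the stage by [gap s]. *)
Record stage_ok (t0 : nat) ord J s : Prop := StageOk {
  gap_gt0 : 0 < gap s;
  dual_ge0 : 0 <= dual s;
  stage_peak : (left_end s <= t0 <= right_end s)%N;
  before_inside : forall i, i \in picked_before s ->
    (left_end s < res_start i)%N && (res_end i < right_end s)%N;
  before_cover : forall t, (left_end s < t < right_end s)%N ->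
    has (fun i => res_active i t) (picked_before s);
  inside_gap : #|inside (left_end s) (right_end s)|%:Z + gap s <= partiality I;
  outside_gap : #|J :\: inside (left_end s) (right_end s)|%:Z
                + (partiality I - #|J|%:Z) <= gap s;
  before_prefix : exists rest, ord = picked_before s ++ rest
}.

Definition critical ord R J i : Prop :=
  exists t, [/\ res_active i t, res_profile R t - capacity i < (job_profile J t)%:Z
    & forall z, (index z ord < index i ord)%N -> ~~ res_active z t].

(** A resource active at an end is not in [picked_before], whose members lie strictly inside. So it
    comes later in [ord], its critical time avoids all of [picked_before], and hence lies outside
    the interval that they cover. Only jobs counted by [outside_gap] are active there. *)
Lemma stage_upper_bound t0 ord J R s : stage_ok t0 ord J s ->
  #|J|%:Z <= partiality I \/ J = set0 ->
  (forall i, (0 < R i)%N -> i \in ord /\ 0 < capacity i) ->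
  (forall i, (0 < R i)%N -> critical ord R J i) ->
  \sum_i stage_weight s i *+ R i <= 8 * gap s.
Proof.
case=> g0 _ hpeak hbi hbc hig hog [rest hord] hJ hord' hcrit.
have hprof t : (forall z, z \in picked_before s -> ~~ res_active z t) ->
    (job_profile J t)%:Z <= gap s.
  move=> hz; have hout : ~~ (left_end s < t < right_end s)%N.
    by apply/negP => /hbc /hasP[z hz1 hz2]; move: (hz _ hz1); rewrite hz2.
  case: hJ => [hJ|->]; last first.
    rewrite /job_profile; suff -> : [set j in set0 | job_active j t] = set0 :> {set 'I_(njobs I)}
      by rewrite cards0 ltW.
    by apply/setP => j; rewrite !inE.
  have : (job_profile J t <= #|J :\: inside (left_end s) (right_end s)|)%N.
    apply: subset_leq_card; apply/subsetP => j; rewrite !inE => /andP[-> hj].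
    by rewrite andbT; move: hj hout; rewrite /job_active; lia.
  lia.
have hunit t : (t = left_end s \/ t = right_end s) -> unit_cost (gap s) R t <= 4 * gap s.
  move=> ht; apply: unit_cost_bound => // [i hi|i ha hR].
    by have [] := hord' _ hi.
  have [t1 [h1 h2 h3]] := hcrit _ hR; exists t1 => //; apply: lt_le_trans h2 _.
  apply: hprof => z hz; apply: h3.
  have hi : i \notin picked_before s.
    apply/negP => /hbi; move: ha; rewrite /res_active; lia.
  rewrite hord !index_cat hz (negbTE hi).
  by apply: leq_trans (leq_addr _ _); rewrite index_mem.
rewrite weight_unit_cost.
have := hunit (left_end s) (or_introl erefl).
have := hunit (right_end s) (or_intror erefl); lia.
Qed.

Lemma sum_charge ss R :
  \sum_i charge ss i *+ R i =
  \sum_(s <- ss) dual s * (\sum_i stage_weight s i *+ R i)%:~R.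
Proof.
under eq_bigr => i _ do rewrite /charge -sumrMnl.
rewrite exchange_big /=; apply: eq_bigr => s _.
by rewrite rmorph_sum mulr_sumr; apply: eq_bigr => i _; rewrite rmorphMn mulrnAr.
Qed.

(** The copies in [R] are paid entirely by charges, and charges never exceed costs for [R'], so the
    two multisets can be compared one stage at a time. *)
Lemma local_ratio_bound t0 ord ss J R :
  (forall j, (job_start j <= t0 <= job_end j)%N) ->
  (forall s, List.In s ss -> stage_ok t0 ord J s) ->
  #|J|%:Z <= partiality I \/ J = set0 ->
  (forall i, (0 < R i)%N -> [/\ i \in ord, 0 < capacity i & res_cost i = charge ss i]) ->
  (forall i, charge ss i <= res_cost i) ->
  (forall i, (0 < R i)%N -> critical ord R J i) ->
  forall R' J', feasible R' J' -> multiset_cost R <= 8%:R * multiset_cost R'.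
Proof.
move=> peak hss hJ hR hch hcrit R' J' hf.
have -> : multiset_cost R = \sum_i charge ss i *+ R i.
  apply: eq_bigr => i _; case: (posnP (R i)) => [->|h]; first by rewrite !mulr0n.
  by have [_ _ ->] := hR i h.
apply: (@le_trans _ _ (8%:R * \sum_i charge ss i *+ R' i)); last first.
  by rewrite ler_wpM2l //; apply: ler_sum => i _; rewrite lerMn2r hch orbT.
rewrite !sum_charge mulr_sumr.
have hR2 i : (0 < R i)%N -> i \in ord /\ 0 < capacity i by move/hR => [].
elim: ss hss {hR hch} => [|s ss IH] hss; first by rewrite !big_nil.
rewrite !big_cons lerD //; last by apply: IH => s' hs'; apply: hss; right.
have hs : stage_ok t0 ord J s by apply: hss; left.
rewrite mulrCA ler_wpM2l ?(dual_ge0 hs) //.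
have h1 := stage_upper_bound hs hJ hR2 hcrit.
have h2 := weight_lower_bound peak (stage_peak hs) (gap_gt0 hs) (inside_gap hs) hf.
rewrite -[8%:R]/((8 : int)%:~R) -intrM ler_int -/(stage_weight s) in h2 *.
by apply: le_trans h1 _; rewrite ler_wpM2l.
Qed.

(** * Invariant of the outward scan *)

(** [cur] holds the residual costs as integers; the true ones are [cur i / scale]. The second case
    of [chosen_card] is for a negative [partiality I], which even the empty set exceeds. *)
Record state_ok (t0 : nat) ord (l r : nat) J (cur : 'I_(nresources I) -> int) : Prop :=
  StateOk {
  state_peak : (l <= t0 <= r)%N;
  order_uniq : uniq ord;
  order_capacity : forall i, i \in ord -> 0 < capacity i;
  order_inside : forall i, i \in ord -> (l < res_start i)%N && (res_end i < r)%N;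
  order_cover : forall t, (l < t < r)%N -> has (fun i => res_active i t) ord;
  chosen_inside : J \subset inside l r;
  chosen_all : #|J|%:Z < partiality I -> J = inside l r;
  chosen_card : #|J|%:Z <= partiality I \/ J = set0;
  cur_ge0 : forall i, 0 <= cur i;
  cur_order : forall i, i \in ord -> cur i = 0;
  state_dual : exists ss (scale : rat), [/\ 0 < scale,
    forall i, res_cost i = (cur i)%:~R / scale + charge ss i &
    forall s, List.In s ss -> stage_ok t0 ord J s]
}.

Lemma state_init t0 cur (scale : rat) : 0 < scale ->
  (forall i, res_cost i = (cur i)%:~R / scale) ->
  state_ok t0 [::] t0 t0 set0 cur.
Proof.
move=> h0 hc; split=> //; try by [|lia].
- by rewrite sub0set.
- move=> _; apply/esym/eqP; rewrite -subset0; apply/subsetP => j; rewrite !inE.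
  by move: (job_wf j); lia.
- by right.
- move=> i; have := res_cost_ge0 i; rewrite hc pmulr_lge0 ?invr_gt0 //.
  by rewrite ler0z.
- exists [::], scale; split => // i; by rewrite hc /charge big_nil addr0.
Qed.

(** [b] has the least ratio of residual cost to weight, so no cost becomes negative and [b] becomes
    free; resources freed earlier have weight zero and stay free. Multiplying by [w b] replaces a
    division and moves into the scale. The new ends lie one step beyond [b], which puts it strictly
    inside. *)
Lemma state_step t0 ord l r J cur b J' (g := partiality I - #|J|%:Z)
    (w := weight l r g) (l' := minn l (res_start b).-1) (r' := maxn r (res_end b).+1) :
  state_ok t0 ord l r J cur -> 0 < g -> 0 < w b ->
  (forall i, 0 < w i -> cur b * w i <= cur i * w b) ->
  J \subset J' -> J' \subset inside l' r' -> #|J'|%:Z <= partiality I ->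
  (#|J'|%:Z < partiality I -> J' = inside l' r') ->
  state_ok t0 (rcons ord b) l' r' J' (fun i => cur i * w b - cur b * w i).
Proof.
case=> hpeak hun hcapo hins hcov hJi hJall hJc cur0 curo [ss [scale [sc0 hcost hss]]].
move=> g0 wb0 hmin sJJ' hJ'i hJ'k hJ'all.
have hlt : #|J|%:Z < partiality I by rewrite -subr_gt0.
have hJ := hJall hlt.
have hb : 0 < capacity b /\ (res_active b l || res_active b r).
  move: wb0; rewrite /w /weight /unit_weight; case: ifP => _; last by rewrite !mul0r.
  by case: (res_active b l); case: (res_active b r); rewrite ?mulr0.
case: hb => capb actb.
have bnew : b \notin ord.
  by apply/negP => /hins; move: actb; rewrite /res_active; lia.
have wo i : i \in ord -> w i = 0.
  move=> hi; have := hins _ hi; rewrite /w /weight /res_active => hh.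
  have -> : (res_start i <= l <= res_end i)%N = false by lia.
  have -> : (res_start i <= r <= res_end i)%N = false by lia.
  by rewrite !mulr0.
have w0 i : 0 <= w i by apply: weight_ge0; rewrite ltW.
have lg : (#|J| <= #|J'|)%N by apply: subset_leq_card.
have hwf := res_wf b; rewrite /res_active in actb.
split => //.
- by rewrite /l' /r'; lia.
- by rewrite rcons_uniq bnew.
- by move=> i; rewrite mem_rcons inE => /orP[/eqP -> //|/hcapo].
- move=> i; rewrite mem_rcons inE => /orP[/eqP ->|/hins]; rewrite /l' /r'; lia.
(* [b] contains [l] or [r], so its interval joins the covered one without a hole. *)
- move=> t ht; rewrite has_rcons /res_active.
  case: (boolP (l < t < r)%N) => [/hcov ->|hn]; first by rewrite orbT.
  apply/orP; left; move: ht hn; rewrite /l' /r'; lia.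
- by left.
- move=> i; have := w0 i; rewrite le_eqVlt => /orP[/eqP <-|/hmin]; last by rewrite subr_ge0.
  by rewrite mulr0 subr0 mulr_ge0 ?cur0 // ltW.
- move=> i; rewrite mem_rcons inE => /orP[/eqP ->|hi]; first by rewrite subrr.
  by rewrite (curo _ hi) (wo _ hi) mul0r mulr0 subrr.
(* The least ratio, expressed in original cost units. *)
pose s := @Stage ord l r g ((cur b)%:~R / (scale * (w b)%:~R)).
have wbq : 0 < (w b)%:~R :> rat by rewrite ltr0z.
exists (s :: ss), (scale * (w b)%:~R); split.
- by rewrite mulr_gt0.
- move=> i; rewrite hcost /charge big_cons /= addrA; congr (_ + _).
  rewrite /stage_weight /= -/(w i) rmorphB !rmorphM /=.
  have h1 : (w b)%:~R != 0 :> rat by rewrite gt_eqF.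
  have h2 : scale != 0 by rewrite gt_eqF.
  by field; rewrite h1 h2.
move=> s' /= [<-|/hss].
  split => //=.
  - by rewrite divr_ge0 ?ler0z ?cur0 // mulr_ge0 ?ltW.
  - by rewrite -hJ /g addrC subrK.
  - rewrite -hJ /g; have := cardsID J J'; rewrite (setIidPr sJJ') => <-.
    by move: #|J| #|_ :\: _| (partiality I) => x y p; lia.
  - by exists [:: b]; rewrite cats1.
case=> h1 h2 h3 h4 h5 h6 h7 [rest h8]; split => //.
  (* The bound of an older stage says that all but [gap] of the [partiality I] required jobs are
     chosen inside [X], and enlarging [J] can only help. *)
  move: h7; set X := inside _ _.
  have := subset_leq_card (setDS X sJJ').
  have hX := cardsID X J; have hX' := cardsID X J'.
  have : (#|J :&: X| <= #|J' :&: X|)%N by rewrite subset_leq_card // setSI.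
  lia.
by exists (rcons rest b); rewrite h8 rcons_cat.
Qed.

(** The lower bound would make the positive gap at most a sum of nonpositive weights. A scan that
    finds no candidate therefore certifies that there is no feasible solution. *)
Lemma stuck_infeasible t0 ord l r J cur :
  (forall j, (job_start j <= t0 <= job_end j)%N) ->
  state_ok t0 ord l r J cur -> #|J|%:Z < partiality I ->
  (forall i, weight l r (partiality I - #|J|%:Z) i <= 0) ->
  forall R' J', ~ feasible R' J'.
Proof.
move=> peak hs hlt hw R' J' hf; have hJ := chosen_all hs hlt.
have := @weight_lower_bound R' J' l r (partiality I - #|J|%:Z) t0 peak (state_peak hs).
rewrite subr_gt0 -hJ => /(_ hlt _ hf) h.
have : partiality I - #|J|%:Z <= 0; last lia.
apply: le_trans (h _) _; first lia.
by apply: sumr_le0 => i _; rewrite mulrn_wle0.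
Qed.

(** * Reverse deletion *)

(* The resources at positions [q] and above of [ord] have been thinned already. *)
Record delete_ok ord J (q : nat) R : Prop := DeleteOk {
  delete_support : forall i, i \notin ord -> R i = 0%N;
  delete_full : forall i, (index i ord < q)%N -> R i = #|J|;
  delete_cover : forall t, (job_profile J t)%:Z <= res_profile R t;
  delete_critical : forall i, (q <= index i ord)%N -> (0 < R i)%N -> critical ord R J i
}.

Lemma profile_le_card J t : (job_profile J t <= #|J|)%N.
Proof. by apply: subset_leq_card; apply/subsetP => j; rewrite inE => /andP[]. Qed.

Definition decr R i : resource_multiset I :=
  [ffun i' => if i' == i then (R i').-1 else R i'].

Lemma decr_profile R i t : (0 < R i)%N ->
  res_profile (decr R i) t = res_profile R t - capacity i *+ res_active i t.
Proof.
move=> hR; rewrite /res_profile; case: (boolP (res_active i t)) => ha; last first.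
  rewrite mulr0n subr0; apply: eq_bigr => i' hi'; rewrite ffunE.
  by case: eqP => // E; rewrite -E hi' in ha.
rewrite (bigD1 i) //= [X in _ = X - _](bigD1 i) //= ffunE eqxx mulr1n.
rewrite -{2}[R i]prednK // mulrS.
rewrite (eq_bigr (fun i' => capacity i' *+ R i')); first by ring.
by move=> i' /andP[_ /negbTE h]; rewrite ffunE h.
Qed.

Lemma res_profile_ge0 ord R t : (forall i, i \in ord -> 0 < capacity i) ->
  (forall i, i \notin ord -> R i = 0%N) -> 0 <= res_profile R t.
Proof.
move=> hc hs; apply: sumr_ge0 => i _; case: (boolP (i \in ord)) => hi.
  by rewrite mulrn_wge0 // ltW // hc.
by rewrite hs // mulr0n.
Qed.

(** A time at which a chosen job is active lies strictly between [l] and [r], so some resource of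
    [ord] is active there. Its capacity is a positive integer, so [#|J|] copies of it carry all
    chosen jobs. *)
Lemma delete_init t0 ord l r J cur : state_ok t0 ord l r J cur ->
  delete_ok ord J (size ord) [ffun i => if i \in ord then #|J| else 0%N].
Proof.
move=> hs; split.
- by move=> i /negbTE hi; rewrite ffunE hi.
- by move=> i; rewrite index_mem ffunE => ->.
- move=> t; case: (posnP (job_profile J t)) => [->|].
    apply: (@res_profile_ge0 ord); first exact: order_capacity hs.
    by move=> i /negbTE hi; rewrite ffunE hi.
  rewrite card_gt0 => /set0Pn[j]; rewrite inE => /andP[hj hjt].
  have /subsetP/(_ _ hj) := chosen_inside hs; rewrite inE => hin.
  have /hasP[i hi hit] : has (fun i => res_active i t) ord.
    by apply: (order_cover hs); move: hjt hin; rewrite /job_active; lia.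
  rewrite /res_profile (bigD1 i) //= ffunE hi; set X := (X in _ + X).
  have : 0 <= X.
    apply: sumr_ge0 => i' _; rewrite ffunE; case: ifP => hi'; last by rewrite mulr0n.
    by rewrite mulrn_wge0 // ltW // (order_capacity hs).
  have := profile_le_card J t; have := order_capacity hs hi.
  rewrite intmulnE; move: X (capacity i) (job_profile _ _) #|J| => x c p n.
  nia.
- by move=> i; rewrite leqNgt index_mem => /negbTE hi; rewrite ffunE hi.
Qed.

(** Deletions only lower the load, so a critical time stays critical and no resource has to be
    thinned again. *)
Lemma critical_decr ord J R i z : (forall i, i \in ord -> 0 < capacity i) ->
  (0 < R z)%N -> z \in ord -> critical ord R J i -> critical ord (decr R z) J i.
Proof.
move=> hc hR hz [t [h1 h2 h3]]; exists t; split => //; rewrite decr_profile //.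
by have := hc _ hz; case: (res_active z t); rewrite ?mulr1n ?mulr0n; lia.
Qed.

(* As [delete_ok], except that the resource at position [q] is only partly thinned. *)
Record deleting ord J (q : nat) R : Prop := Deleting {
  deleting_support : forall i, i \notin ord -> R i = 0%N;
  deleting_full : forall i, (index i ord < q)%N -> R i = #|J|;
  deleting_cover : forall t, (job_profile J t)%:Z <= res_profile R t;
  deleting_critical : forall i, (q < index i ord)%N -> (0 < R i)%N -> critical ord R J i
}.

Lemma deleting_start ord J q R : delete_ok ord J q.+1 R -> deleting ord J q R.
Proof. by case=> h1 h2 h3 h4; split => // i hi; apply: h2; rewrite ltnS ltnW. Qed.

Lemma deleting_succeed ord J q R i : (forall i, i \in ord -> 0 < capacity i) ->
  i \in ord -> index i ord = q -> (0 < R i)%N -> deleting ord J q R ->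
  (forall t, (job_profile J t)%:Z <= res_profile (decr R i) t) ->
  deleting ord J q (decr R i).
Proof.
move=> hc hi hq hR [h1 h2 h3 h4] hcov; split => //.
- by move=> i' hi'; rewrite ffunE h1 // if_same.
- by move=> i' hi'; rewrite ffunE; case: eqP => [E|_]; [rewrite E hq ltnn in hi'|apply: h2].
- move=> i' hi'; rewrite ffunE; case: eqP => [E|_ hR']; first by rewrite E hq ltnn in hi'.
  by apply: critical_decr => //; apply: h4.
Qed.

(** The time [t] of the failure is critical: [i] is active there, since otherwise the load would not
    have changed, and an earlier resource active there would still have all its [#|J|] copies and
    cover [t] alone. *)
Lemma deleting_fail ord J q R i t : (forall i, i \in ord -> 0 < capacity i) ->
  i \in ord -> index i ord = q -> (0 < R i)%N -> deleting ord J q R ->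
  res_profile (decr R i) t < (job_profile J t)%:Z -> critical ord R J i.
Proof.
move=> hc hi hq hR [h1 h2 h3 h4]; rewrite decr_profile // => hlt.
have ha : res_active i t.
  by apply: contraLR hlt => /negbTE ->; rewrite mulr0n subr0 -leNgt.
rewrite ha mulr1n in hlt; exists t; split => // z hz; rewrite hq in hz.
apply/negP => hzt; move: hlt; rewrite /res_profile (bigD1 i) //= (bigD1 z) /=; last first.
  by rewrite hzt /=; apply: contraTN hz => /eqP ->; rewrite hq ltnn.
have hzo : z \in ord.
  by rewrite -index_mem (leq_trans hz) // -hq index_size.
rewrite (h2 z) //; set X := (X in _ + (_ + X)).
have : 0 <= X.
  apply: sumr_ge0 => y _; case: (boolP (y \in ord)) => hy.
    by rewrite mulrn_wge0 // ltW // hc.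
  by rewrite h1 // mulr0n.
have := profile_le_card J t; have := hc _ hzo; have := hc _ hi.
rewrite !intmulnE; move: X (capacity i) (capacity z) (R i) (job_profile _ _) #|J| hR.
by move=> x c c' m p n; nia.
Qed.

Lemma deleting_stop ord J q R :
  (forall i, (index i ord = q) -> (0 < R i)%N -> critical ord R J i) ->
  deleting ord J q R -> delete_ok ord J q R.
Proof.
move=> hq [h1 h2 h3 h4]; split => // i; rewrite leq_eqVlt => /orP[/eqP hi|/h4 //].
exact: hq.
Qed.

Lemma approximation_bound t0 ord l r J cur R :
  (forall j, (job_start j <= t0 <= job_end j)%N) ->
  state_ok t0 ord l r J cur -> delete_ok ord J 0 R ->
  forall R' J', feasible R' J' -> multiset_cost R <= 8%:R * multiset_cost R'.
Proof.
move=> peak hs [h1 h2 h3 h4]; have [ss [scale [sc0 hcost hss]]] := state_dual hs.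
have hmem i : (0 < R i)%N -> i \in ord by apply: contraLR => /h1 ->.
apply: (local_ratio_bound peak hss) => //.
- exact: chosen_card hs.
- move=> i /hmem hi; split => //; first exact: (order_capacity hs).
  by rewrite hcost (cur_order hs hi) mul0r add0r.
- by move=> i; rewrite hcost lerDr divr_ge0 ?ler0z ?(cur_ge0 hs) // ltW.
- by move=> i; apply: h4.
Qed.

(* The job profile can only increase at a job start, and the load can only
   decrease right after the end of a resource. *)
Lemma covers_breakpoints R J : (forall i, (0 < R i)%N -> 0 <= capacity i) ->
  (forall j, (job_profile J (job_start j))%:Z <= res_profile R (job_start j)) ->
  (forall i, (job_profile J (res_end i).+1)%:Z <= res_profile R (res_end i).+1) ->
  forall t, (job_profile J t)%:Z <= res_profile R t.
Proof.
move=> hc hj hr; elim => [|t IH].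
  by have [-> ->] := @profile_outside R J 0%N isT.
have [/existsP[j /eqP <-]|] := boolP [exists j : 'I_(njobs I), job_start j == t.+1].
  exact: hj.
rewrite negb_exists => /forallP hj'.
have [/existsP[i /eqP <-]|] := boolP [exists i : 'I_(nresources I), res_end i == t].
  exact: hr.
rewrite negb_exists => /forallP hr'.
have h1 : (job_profile J t.+1 <= job_profile J t)%N.
  apply: subset_leq_card; apply/subsetP => j; rewrite !inE => /andP[-> h] /=.
  by move: h (hj' j); rewrite /job_active; lia.
rewrite -lez_nat in h1; apply: (le_trans h1); apply: (le_trans IH);
  rewrite /res_profile big_mkcond [X in _ <= X]big_mkcond /=.
apply: ler_sum => i _; move: (hr' i); rewrite /res_active => hri.
case: (posnP (R i)) => [->|hR]; first by rewrite !mulr0n !if_same.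
case: ifP => ha; last by case: ifP => // _; rewrite mulrn_wge0 // hc.
by have -> : (res_start i <= t.+1 <= res_end i)%N by lia.
Qed.

End LocalRatio.

(** * A structured language on top of the machine *)

(* Array [0] is the half-line of nonnegative addresses, used for input and output;
   arrays [1], ..., [64] are interleaved on the negative addresses. A scalar
   variable is the cell of index [0] of an array. *)
Definition store := nat -> nat -> int.

Definition mem (W : store) : memory := fun a =>
  match a with Posz p => W 0%N p | Negz x => W (x %% 64).+1 (x %/ 64)%N end.

Definition upd (W : store) (c i : nat) (v : int) : store :=
  fun c' i' => if (c' == c) && (i' == i) then v else W c' i'.

Inductive sexpr :=
  | K of int
  | A of nat & sexpr
  | Plus of sexpr & sexpr
  | Minus of sexpr & sexpr.

Notation V c := (A c (K (Posz 0))).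

Fixpoint seval (W : store) (e : sexpr) : int :=
  match e with
  | K z => z
  | A c e1 => W c `|seval W e1|%N
  | Plus e1 e2 => seval W e1 + seval W e2
  | Minus e1 e2 => seval W e1 - seval W e2
  end.

(* A negative index would reach into another array. *)
Fixpoint safe (W : store) (e : sexpr) : bool :=
  match e with
  | K _ => true
  | A c e1 => [&& (c <= 64)%N, safe W e1 & 0 <= seval W e1]
  | Plus e1 e2 | Minus e1 e2 => safe W e1 && safe W e2
  end.

(** * Compilation of expressions *)

Definition double (e : expr) := Add e e.

(** Six doublings multiply the index by 64, the number of interleaved arrays. They duplicate the
    expression, but only by a factor fixed by the program. *)
Definition address (c : nat) (e : expr) : expr :=
  if c is c'.+1 then Sub (Const (Negz c')) (iter 6 double e) else e.

Fixpoint compile_expr (e : sexpr) : expr :=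
  match e with
  | K z => Const z
  | A c e1 => Read (address c (compile_expr e1))
  | Plus e1 e2 => Add (compile_expr e1) (compile_expr e2)
  | Minus e1 e2 => Sub (compile_expr e1) (compile_expr e2)
  end.

Definition location (c i : nat) : int :=
  if c is c'.+1 then Negz (c' + 64 * i) else Posz i.

Lemma eval_address m c e i :
  eval m e = Posz i -> eval m (address c e) = location c i.
Proof.
by case: c => [|c] He //=; rewrite He NegzE; lia.
Qed.

Lemma mem_location W c i : (c <= 64)%N -> mem W (location c i) = W c i.
Proof.
case: c => [|c] //= hc.
have -> : ((c + 64 * i) %% 64 = c)%N by lia.
by have -> : ((c + 64 * i) %/ 64 = i)%N by lia.
Qed.

Lemma update_mem W c i v : (c <= 64)%N ->
  update (mem W) (location c i) v = mem (upd W c i v).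
Proof.
move=> hc; apply: functional_extensionality => a; rewrite /update /upd.
case: c hc => [|c] hc; case: a => x //=.
rewrite eqSS; have -> // : (Negz x == Negz (c + 64 * i)) = (x %% 64 == c)%N && (x %/ 64 == i)%N.
have -> : (Negz x == Negz (c + 64 * i)) = (x == c + 64 * i)%N by [].
apply/eqP/andP => [->|[/eqP h1 /eqP h2]]; last lia.
by split; apply/eqP; lia.
Qed.

Lemma eval_compile W e : safe W e -> eval (mem W) (compile_expr e) = seval W e.
Proof.
elim: e => [z|c e IH|e1 IH1 e2 IH2|e1 IH1 e2 IH2] //=.
- case/and3P => hc hs h0; rewrite (@eval_address _ _ _ `|seval W e|%N) ?mem_location //.
  by rewrite IH // gez0_abs.
- by case/andP => h1 h2; rewrite IH1 // IH2.
- by case/andP => h1 h2; rewrite IH1 // IH2.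
Qed.

(** * Statements, their translation and their running time *)

Notation vMA := 61%N.
Notation vMB := 62%N.
Notation vMR := 63%N.
Notation vMH := 64%N.

Inductive stmt :=
  | Nop
  | Put of nat & sexpr & sexpr
  | Then of stmt & stmt
  | If of sexpr & stmt & stmt
  | For of nat & sexpr & stmt
  | Mul.

Notation SetReg c e := (Put c (K (Posz 0)) e).
Notation "s1 ;; s2" := (Then s1 s2) (at level 70, right associativity).

Definition assign c (e v : expr) := Write (address c e) v.
Definition reg c := Read (address c (Const 0)).

(* Russian peasant multiplication, the only loop whose length depends on the
   size of the numbers rather than on their count. *)
Definition mul_loop :=
  WhilePos (reg vMB)
    (Seq (assign vMH (Const 0) (Half (reg vMB)))
    (Seq (IfPos (Sub (reg vMB) (double (reg vMH)))
           (assign vMR (Const 0) (Add (reg vMR) (reg vMA))) Skip)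
    (Seq (assign vMA (Const 0) (double (reg vMA)))
         (assign vMB (Const 0) (reg vMH))))).

Fixpoint compile (p : stmt) : cmd :=
  match p with
  | Nop => Skip
  | Put c e v => assign c (compile_expr e) (compile_expr v)
  | Then p1 p2 => Seq (compile p1) (compile p2)
  | If e p1 p2 => IfPos (compile_expr e) (compile p1) (compile p2)
  | For x b p1 =>
      Seq (assign x (Const 0) (Const 0))
          (WhilePos (compile_expr (Minus b (V x)))
             (Seq (compile p1)
                  (assign x (Const 0) (compile_expr (Plus (V x) (K 1))))))
  | Mul => Seq (assign vMR (Const 0) (Const 0)) mul_loop
  end.

(** [N] bounds the iterations of every [For], and [N.+1] the bits of every multiplier. A round of a
    [For] costs its body, a test and an increment; a round of [Mul] costs six units. *)
Fixpoint time (N : nat) (p : stmt) : nat :=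
  match p with
  | Nop => 1
  | Put _ _ _ => 1
  | Then p1 p2 => time N p1 + time N p2
  | If _ p1 p2 => (maxn (time N p1) (time N p2)).+1
  | For _ _ p1 => 2 + N * (time N p1 + 2)
  | Mul => 2 + 6 * N.+1
  end.

Fixpoint degree (p : stmt) : nat :=
  match p with
  | Nop | Put _ _ _ => 0
  | Then p1 p2 | If _ p1 p2 => maxn (degree p1) (degree p2)
  | For _ _ p1 => (degree p1).+1
  | Mul => 1
  end.

(** The constants absorb lower-order terms for positive [N]: [2 + 2 * N <= 4 * N] for a loop and
    [8 + 6 * N <= 14 * N] for a product. *)
Fixpoint coefficient (p : stmt) : nat :=
  match p with
  | Nop | Put _ _ _ => 1
  | Then p1 p2 | If _ p1 p2 => coefficient p1 + coefficient p2 + 1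
  | For _ _ p1 => coefficient p1 + 4
  | Mul => 14
  end.

Lemma time_polynomial N p : (0 < N)%N ->
  (time N p <= coefficient p * N ^ degree p)%N.
Proof.
move=> N0; have gt0 d : (0 < N ^ d)%N by rewrite expn_gt0 N0.
have mono c d d' : (d <= d')%N -> (c * N ^ d <= c * N ^ d')%N.
  by move=> h; rewrite leq_mul2l leq_pexp2l ?orbT.
elim: p => [|c e v|p1 IH1 p2 IH2|e p1 IH1 p2 IH2|x b p1 IH1|] //=.
- have := leq_trans IH1 (mono _ _ _ (leq_maxl (degree p1) (degree p2))).
  have := leq_trans IH2 (mono _ _ _ (leq_maxr (degree p1) (degree p2))).
  by move: (N ^ _)%N (gt0 (maxn (degree p1) (degree p2))); nia.
- have := leq_trans IH1 (mono _ _ _ (leq_maxl (degree p1) (degree p2))).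
  have := leq_trans IH2 (mono _ _ _ (leq_maxr (degree p1) (degree p2))).
  by move: (N ^ _)%N (gt0 (maxn (degree p1) (degree p2))); nia.
- rewrite expnS; move: (N ^ _)%N (gt0 (degree p1)) IH1 => M M0 IH1.
  have h1 : (N * time N p1 <= N * (coefficient p1 * M))%N by rewrite leq_mul2l IH1 orbT.
  have h2 : (N <= N * M)%N by rewrite leq_pmulr.
  rewrite mulnDl mulnDr (mulnCA _ N M); lia.
- by rewrite expn1; lia.
Qed.

(** * Total correctness with a time bound *)

Definition triple (N : nat) (p : stmt) (W : store) (Q : store -> Prop) : Prop :=
  exists W' n, [/\ exec (compile p) (mem W) (mem W') n, (n <= time N p)%N & Q W'].

(** Frame condition: only the arrays listed in [S] may change, and those at every index. *)
Definition same_off (S : seq nat) (W W' : store) : Prop :=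
  forall c i, c \notin S -> W' c i = W c i.

Lemma same_off_trans S W1 W2 W3 :
  same_off S W1 W2 -> same_off S W2 W3 -> same_off S W1 W3.
Proof. by move=> h1 h2 c i hc; rewrite h2 ?h1. Qed.

Lemma same_off_sub S S' W1 W2 :
  {subset S <= S'} -> same_off S W1 W2 -> same_off S' W1 W2.
Proof. by move=> sSS' h c i hc; apply: h; apply: contra hc; apply: sSS'. Qed.

Lemma same_off_upd S W W' c i v :
  c \in S -> same_off S W W' -> same_off S W (upd W' c i v).
Proof.
move=> cS h c' i' hc; rewrite /upd; case: eqP => [E|_] /=; last exact: h.
by rewrite E cS in hc.
Qed.

Lemma triple_nop N W Q : Q W -> triple N Nop W Q.
Proof. by move=> h; exists W, 1%N; split => //; apply: ExecSkip. Qed.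

Lemma exec_assign W c e v i x : (c <= 64)%N -> eval (mem W) e = Posz i ->
  eval (mem W) v = x -> exec (assign c e v) (mem W) (mem (upd W c i x)) 1.
Proof.
move=> hc he <-; rewrite -update_mem // -(eval_address c he); exact: ExecWrite.
Qed.

Lemma triple_put N c e v W (Q : store -> Prop) :
  (c <= 64)%N -> safe W e -> 0 <= seval W e -> safe W v ->
  Q (upd W c `|seval W e|%N (seval W v)) -> triple N (Put c e v) W Q.
Proof.
move=> hc hs h0 hv hQ; exists (upd W c `|seval W e|%N (seval W v)), 1%N.
split => //=; apply: exec_assign; rewrite ?eval_compile ?gez0_abs //.
Qed.

Lemma triple_set N c v W (Q : store -> Prop) :
  (c <= 64)%N -> safe W v -> Q (upd W c 0%N (seval W v)) ->
  triple N (SetReg c v) W Q.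
Proof. by move=> hc hv hQ; apply: triple_put. Qed.

Lemma triple_then N p1 p2 W Q :
  triple N p1 W (fun W1 => triple N p2 W1 Q) -> triple N (p1 ;; p2) W Q.
Proof.
move=> [W1 [n1 [h1 h2 [W2 [n2 [h3 h4 h5]]]]]]; exists W2, (n1 + n2)%N.
by split => //=; [apply: ExecSeq h1 h3 | apply: leq_add].
Qed.

Lemma triple_if N e p1 p2 W Q : safe W e ->
  (0 < seval W e -> triple N p1 W Q) -> (seval W e <= 0 -> triple N p2 W Q) ->
  triple N (If e p1 p2) W Q.
Proof.
move=> hs h1 h2; case: (ltrP 0 (seval W e)) => he.
- have [W' [n [h3 h4 h5]]] := h1 he; exists W', n.+1; split => //=.
  + by apply: ExecIfTrue => //; rewrite eval_compile.
  + by rewrite ltnS (leq_trans h4) // leq_maxl.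
- have [W' [n [h3 h4 h5]]] := h2 he; exists W', n.+1; split => //=.
  + by apply: ExecIfFalse => //; rewrite eval_compile.
  + by rewrite ltnS (leq_trans h4) // leq_maxr.
Qed.

(** The bound is re-evaluated at every test, so it must have the value [n] in every store that the
    loop can reach. The frame [S] carries along all that the body leaves alone, so [Inv] need only
    speak of what changes. *)
Lemma triple_for N x b p W n S (Inv : nat -> store -> Prop) (Q : store -> Prop) :
  (n <= N)%N -> (x <= 64)%N -> x \notin S ->
  (forall W', same_off (x :: S) W W' -> safe W' b /\ seval W' b = Posz n) ->
  Inv 0%N (upd W x 0%N 0) ->
  (forall i W', (i < n)%N -> same_off (x :: S) W W' -> W' x 0%N = Posz i ->
     Inv i W' ->
     triple N p W' (fun W2 => same_off S W' W2 /\
                              Inv i.+1 (upd W2 x 0%N (Posz i.+1)))) ->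
  (forall W', same_off (x :: S) W W' -> Inv n W' -> Q W') ->
  triple N (For x b p) W Q.
Proof.
move=> nN hx xS hb h0 hstep hQ.
set w := WhilePos (compile_expr (Minus b (V x)))
           (Seq (compile p) (assign x (Const 0) (compile_expr (Plus (V x) (K 1))))).
have loop k : forall i W', (i + k = n)%N -> same_off (x :: S) W W' ->
    W' x 0%N = Posz i -> Inv i W' ->
    exists W2 t, [/\ exec w (mem W') (mem W2) t, (t <= 1 + k * (time N p + 2))%N & Q W2].
  elim: k => [|k IH] i W' hik hW hi hI.
    have [sb eb] := hb _ hW.
    exists W', 1%N; split=> //; last by apply: hQ => //; rewrite -hik addn0.
    apply: ExecWhileFalse; rewrite eval_compile /= ?sb ?hx //= eb hi -hik; lia.
  have hin : (i < n)%N by lia.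
  have [W2 [t [h1 h2 [h3 h4]]]] := hstep _ _ hin hW hi hI.
  have [sb eb] := hb _ hW.
  have hx2 : W2 x 0%N = Posz i by rewrite h3.
  have hW2 : same_off (x :: S) W (upd W2 x 0%N (Posz i.+1)).
    apply: same_off_upd; first exact: mem_head.
    apply: same_off_trans hW _; apply: same_off_sub h3 => y.
    by rewrite inE orbC => ->.
  have [||W3 [t' [h5 h6 h7]]] := IH i.+1 (upd W2 x 0%N (Posz i.+1)) _ hW2 _ h4.
  - by lia.
  - by rewrite /upd !eqxx.
  exists W3, ((t + 1) + t').+1; split => //; last by rewrite mulSn; lia.
  apply: (@ExecWhileTrue _ _ _ (mem (upd W2 x 0%N (Posz i.+1)))) => //.
  - by rewrite eval_compile /= ?sb ?hx //= eb hi; lia.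
  - apply: ExecSeq h1 _; apply: exec_assign => //.
    by rewrite eval_compile /= ?hx //= hx2; lia.
have [||W2 [t [h1 h2 h3]]] := loop n 0%N (upd W x 0%N 0) (add0n n) _ _ h0.
- by apply: same_off_upd; rewrite ?mem_head.
- by rewrite /upd !eqxx.
exists W2, (1 + t)%N; split => //=; first by apply: ExecSeq h1; apply: exec_assign.
have : (n * (time N p + 2) <= N * (time N p + 2))%N by rewrite leq_mul2r nN orbT.
lia.
Qed.

(** * Multiplication *)

Lemma eval_reg W c : (c <= 64)%N -> eval (mem W) (reg c) = W c 0%N.
Proof. by move=> hc; rewrite /= (@eval_address _ _ _ 0%N) // mem_location. Qed.

(** The value of [vMR + vMA * vMB] is preserved: an odd multiplier adds [vMA] to the result, then
    [vMA] doubles and [vMB] halves. Only the multiplier [b] has to be short; the other factor is an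
    arbitrary integer. *)
Lemma mul_loop_spec L W (b : nat) : W vMB 0%N = b%:Z -> (b < 2 ^ L)%N ->
  exists W' t, [/\ exec mul_loop (mem W) (mem W') t, (t <= 1 + 6 * L)%N,
    same_off [:: vMA; vMB; vMR; vMH] W W' &
    W' vMR 0%N = W vMR 0%N + W vMA 0%N * b%:Z].
Proof.
elim: L W b => [|L IH] W b hb hL.
  have b0 : b = 0%N by case: b hL {hb} => // b; rewrite expn0.
  exists W, 1%N; split => //; last by rewrite b0 mulr0 addr0.
  by apply: ExecWhileFalse; rewrite eval_reg // hb b0.
case: (posnP b) => [b0|bgt0].
  exists W, 1%N; split => //; last by rewrite b0 mulr0 addr0.
  by apply: ExecWhileFalse; rewrite eval_reg // hb b0.
have hb2 := odd_double_half b.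
pose W1 := upd W vMH 0%N (b./2)%:Z.
pose W2 := if odd b then upd W1 vMR 0%N (W vMR 0%N + W vMA 0%N) else W1.
pose W3 := upd W2 vMA 0%N (W vMA 0%N + W vMA 0%N).
pose W4 := upd W3 vMB 0%N (b./2)%:Z.
have [//||W5 [t [h1 h2 h3 h4]]] := IH W4 (b./2).
  by rewrite expnS in hL; lia.
have e2 c : c != vMR -> W2 c 0%N = W1 c 0%N.
  by move=> /negbTE hc; rewrite /W2; case: (odd b) => //; rewrite /upd hc.
have [n2 [n2le ex2]] : exists n2, (n2 <= 2)%N /\
  exec (IfPos (Sub (reg vMB) (double (reg vMH)))
           (assign vMR (Const 0) (Add (reg vMR) (reg vMA))) Skip) (mem W1) (mem W2) n2.
  have ev : eval (mem W1) (Sub (reg vMB) (double (reg vMH))) = (odd b)%:Z.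
    rewrite -[LHS]/(eval (mem W1) (reg vMB)
      - (eval (mem W1) (reg vMH) + eval (mem W1) (reg vMH))).
    by rewrite !eval_reg // /W1 /upd /= hb; lia.
  exists 2%N; split => //; rewrite /W2; case ob : (odd b) ev => ev.
    apply: ExecIfTrue; first by rewrite ev.
    exact: exec_assign.
  apply: ExecIfFalse; first by rewrite ev.
  exact: ExecSkip.
exists W5, ((1 + (n2 + (1 + 1))) + t).+1; split => //; last 2 first.
- apply: same_off_trans h3; apply: same_off_upd => //; apply: same_off_upd => //.
  by rewrite /W2; case: (odd b); repeat apply: same_off_upd => //.
- rewrite h4 /W4 /W3 /upd /=.
  have -> : W2 vMR 0%N = W vMR 0%N + (odd b)%:Z * W vMA 0%N.
    rewrite /W2 /W1 /upd; case: (odd b) => /=; [ring|ring].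
  have -> : b%:Z = (odd b)%:Z + (b./2)%:Z + (b./2)%:Z by lia.
  ring.
- apply: ExecWhileTrue h1; first by rewrite eval_reg // hb; lia.
  apply: (@ExecSeq _ _ _ (mem W1)).
    apply: exec_assign => //.
    have -> : eval (mem W) (Half (reg vMB)) = (eval (mem W) (reg vMB) %/ 2)%Z by [].
    by rewrite eval_reg // hb; lia.
  apply: ExecSeq ex2 _; apply: (@ExecSeq _ _ _ (mem W3)).
    apply: exec_assign => //.
    have -> : eval (mem W2) (double (reg vMA)) = eval (mem W2) (reg vMA) + eval (mem W2) (reg
      vMA) by [].
    by rewrite !eval_reg // e2.
  apply: exec_assign => //.
  by rewrite eval_reg // /W3 /upd /= e2.
- by lia.
Qed.

Definition MulTo d e1 e2 := SetReg vMA e1 ;; SetReg vMB e2 ;; Mul ;; SetReg d (V vMR).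

(** [e2] is read after [vMA] has been overwritten, hence the hypotheses about [upd W vMA 0 v]. The
    bound concerns [e2] alone, so costs may appear as [e1] however long they have become. *)
Lemma triple_mul N d e1 e2 W (Q : store -> Prop) :
  (d < 61)%N -> safe W e1 -> (forall v, safe (upd W vMA 0 v) e2) ->
  (forall v, seval (upd W vMA 0 v) e2 = seval W e2) ->
  0 <= seval W e2 < 2 ^+ N.+1 ->
  (forall W', same_off [:: d; vMA; vMB; vMR; vMH] W W' ->
     W' d 0%N = seval W e1 * seval W e2 -> Q W') ->
  triple N (MulTo d e1 e2) W Q.
Proof.
move=> hd s1 s2 ev2 /andP[e0 eN] hQ.
apply: triple_then; apply: triple_set => //.
apply: triple_then; apply: triple_set => //.
apply: triple_then; rewrite ev2.
set W1 := upd _ vMB _ _.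
have [||W2 [t [h1 h2 h3 h4]]] := @mul_loop_spec N.+1 (upd W1 vMR 0%N 0) `|seval W e2|%N.
- by rewrite /upd /= gez0_abs.
- by rewrite -ltz_nat gez0_abs // -natz natrX natz.
exists W2, (1 + t)%N; split => /=; last 1 first.
- apply: triple_set => //; first by lia.
  apply: hQ.
    apply: same_off_upd; first by rewrite mem_head.
    apply: (@same_off_trans _ _ (upd W1 vMR 0%N 0)).
      by repeat apply: same_off_upd; rewrite ?inE ?eqxx ?orbT.
    by apply: same_off_sub h3 => c hc; rewrite in_cons hc orbT.
  by rewrite /upd !eqxx /= h4 /upd /= add0r gez0_abs.
- by apply: ExecSeq h1; apply: exec_assign.
- by lia.
Qed.

(** * Reading the input *)

Notation vCOST := 1%N.
Notation vJOB := 2%N.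
Notation vWEIGHT := 3%N.
Notation vORDER := 4%N.
Notation vLOAD := 5%N.
Notation vMULT := 6%N.
Notation vL := 7%N.
Notation vR := 8%N.
Notation vCNT := 9%N.
Notation vSIZE := 10%N.
Notation vBEST := 11%N.
Notation vFOUND := 12%N.
Notation vBAD := 13%N.
Notation vD := 14%N.
Notation vT := 15%N.
Notation vG := 16%N.
Notation vWB := 17%N.
Notation vCB := 18%N.
Notation vT1 := 19%N.
Notation vT2 := 20%N.
Notation vX := 21%N.
Notation vY := 22%N.
Notation vZ := 23%N.
Notation vU := 24%N.
Notation vCUR := 25%N.
Notation vN := 26%N.
Notation vM := 27%N.

Notation kE := (A 0 (K (Posz 1))).
Notation nE := (A 0 (K (Posz 2))).
Notation mE := (A 0 (K (Posz 3))).

(** Four header cells precede two cells per job and then five per resource; the multiples of 2 and 5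
    are written as sums. *)
Definition job_field (f x : nat) : sexpr :=
  A 0 (Plus (K (Posz (4 + f))) (Plus (V x) (V x))).

Definition res_field (f x : nat) : sexpr :=
  A 0 (Plus (Plus (K (Posz (4 + f))) (Plus nE nE))
            (Plus (V x) (Plus (Plus (V x) (V x)) (Plus (V x) (V x))))).

Notation jstart x := (job_field 0 x).
Notation jend x := (job_field 1 x).
Notation rstart x := (res_field 0 x).
Notation rend x := (res_field 1 x).
Notation rcap x := (res_field 2 x).
Notation rnum x := (res_field 3 x).
Notation rden x := (res_field 4 x).

Section Input.

Variable I : instance.

Notation n := (njobs I).
Notation m := (nresources I).
Notation N := (input_size I).

Definition input_ok (W : store) := forall p, W 0%N p = nth 0 (encode I) p.

Lemma nth_flatten_uniform (T : Type) (x0 : T) k d (g : 'I_k -> seq T) (i : 'I_k) f tl :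
  (forall i, size (g i) = d) -> (f < d)%N ->
  nth x0 (flatten [seq g i | i : 'I_k] ++ tl) (d * i + f) = nth x0 (g i) f.
Proof.
move=> hd hf.
have gen (s : seq 'I_k) (q : nat) : (q < size s)%N ->
    nth x0 (flatten [seq g i | i <- s] ++ tl) (d * q + f) = nth x0 (g (nth i s q)) f.
  elim: s q => [|y s IH] [|q] //= hq; first by rewrite muln0 -catA nth_cat hd hf.
  rewrite -catA nth_cat hd mulnS -addnA -[X in (_ < X)%N]addn0 ltn_add2l ltn0.
  by rewrite addKn IH.
have hi : (i < size (enum 'I_k))%N by rewrite size_enum_ord.
by rewrite (gen _ _ hi) nth_ord_enum.
Qed.

Lemma size_flatten_uniform (T : Type) k d (g : 'I_k -> seq T) :
  (forall i, size (g i) = d) -> size (flatten [seq g i | i : 'I_k]) = (d * k)%N.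
Proof.
move=> hd; rewrite /image_mem -[k in RHS](size_enum_ord k).
elim: (enum 'I_k) => [|y s IH] /=; first by rewrite muln0.
by rewrite size_cat hd IH mulnS.
Qed.

Lemma encode_head : [/\ nth 0 (encode I) 1 = partiality I,
  nth 0 (encode I) 2 = n%:Z & nth 0 (encode I) 3 = m%:Z].
Proof. by []. Qed.

Lemma encode_job (j : 'I_n) f : (f < 2)%N ->
  nth 0 (encode I) (4 + (f + (j + j))) = nth 0 [:: (job_start j)%:Z; (job_end j)%:Z] f.
Proof.
move=> hf; rewrite /encode nth_cat -[size _]/4%N ltnNge leq_addr addKn [LHS]/=.
rewrite addnn -muln2 mulnC addnC.
by rewrite (@nth_flatten_uniform _ 0 n 2 (fun j => [:: (job_start j)%:Z; (job_end j)%:Z])).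
Qed.

Lemma encode_res (i : 'I_m) f : (f < 5)%N ->
  nth 0 (encode I) (4 + f + (n + n) + (i + ((i + i) + (i + i)))) =
  nth 0 [:: (res_start i)%:Z; (res_end i)%:Z; capacity i;
            numq (res_cost i); denq (res_cost i)] f.
Proof.
move=> hf; rewrite /encode nth_cat -[size _]/4%N -!addnA ltnNge leq_addr addKn [LHS]/=.
rewrite nth_cat (@size_flatten_uniform _ n 2) //.
have -> : (f + (n + (n + (i + (i + (i + (i + i)))))) = 2 * n + (5 * i + f))%N by lia.
rewrite ltnNge leq_addr /= addKn -[flatten _]cats0.
by rewrite (@nth_flatten_uniform _ 0 m 5
  (fun i => [:: (res_start i)%:Z; (res_end i)%:Z; capacity i;
            numq (res_cost i); denq (res_cost i)])).
Qed.

Lemma job_field_ok W x f (j : 'I_n) : input_ok W -> W x 0%N = Posz j ->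
  (x <= 64)%N -> (f < 2)%N ->
  safe W (job_field f x) /\
  seval W (job_field f x) = nth 0 [:: (job_start j)%:Z; (job_end j)%:Z] f.
Proof.
move=> hin hx hx64 hf; rewrite /job_field.
set e0 := Plus _ _.
have e : seval W e0 = Posz (4 + (f + (j + j))) by rewrite /e0 /= hx; lia.
split; last by rewrite -[LHS]/(W 0%N `|seval W e0|%N) e hin encode_job.
by rewrite -[X in is_true X]/[&& (0 <= 64)%N, safe W e0 & 0 <= seval W e0] e /= hx64.
Qed.

Lemma res_field_ok W x f (i : 'I_m) : input_ok W -> W x 0%N = Posz i ->
  (x <= 64)%N -> (f < 5)%N ->
  safe W (res_field f x) /\
  seval W (res_field f x) = nth 0 [:: (res_start i)%:Z; (res_end i)%:Z; capacity i;
            numq (res_cost i); denq (res_cost i)] f.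
Proof.
move=> hin hx hx64 hf; rewrite /res_field.
set e0 := Plus _ _.
have e : seval W e0 = Posz (4 + f + (n + n) + (i + ((i + i) + (i + i)))).
  rewrite /e0 /= hx (hin 2%N); have [_ -> _] := encode_head; lia.
split; last by rewrite -[LHS]/(W 0%N `|seval W e0|%N) e hin encode_res.
by rewrite -[X in is_true X]/[&& (0 <= 64)%N, safe W e0 & 0 <= seval W e0] e /= hx64.
Qed.

Lemma input_size_ge : (4 + 2 * n + 5 * m <= N)%N.
Proof.
have -> : (4 + 2 * n + 5 * m = size (encode I))%N.
  by rewrite /encode !size_cat /= (@size_flatten_uniform _ n 2) // (@size_flatten_uniform _ m 5).
by rewrite /input_size -sum1_size; apply: leq_sum => z _.
Qed.

Lemma njobs_le_size : (n <= N)%N. Proof. by have := input_size_ge; lia. Qed.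
Lemma nresources_le_size : (m <= N)%N. Proof. by have := input_size_ge; lia. Qed.

Lemma encode_lt p : nth 0 (encode I) p < 2 ^+ N.
Proof.
case: (ltnP p (size (encode I))) => hp; last by rewrite nth_default // exprn_gt0.
set z := nth 0 (encode I) p.
have hb : (bit_length z <= N)%N.
  rewrite /input_size (big_rem z) /=; last exact: mem_nth.
  exact: leq_addr.
have : (`|z| < 2 ^ N)%N.
  apply: leq_trans (leq_pexp2l _ hb) => //; exact: trunc_log_ltn.
by rewrite -ltz_nat -[X in _ < X -> _]natz natrX natz => h; apply: le_lt_trans h; lia.
Qed.

(** A resource active at both ends can weigh twice the gap, which is the reason for the exponent
    [N.+1] in the bound on multipliers. *)
Lemma partiality_lt : 2 * partiality I < 2 ^+ N.+1.
Proof. by have := encode_lt 1; have [-> _ _] := encode_head; rewrite exprS ltr_pM2l. Qed.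

Lemma denq_lt (i : 'I_m) : denq (res_cost i) < 2 ^+ N.+1.
Proof.
have := encode_lt (4 + 4 + (n + n) + (i + ((i + i) + (i + i)))); rewrite encode_res //=.
by move=> h; apply: lt_trans h _; rewrite ltr_eXn2l.
Qed.

Lemma nat_lt_size p : (p <= N)%N -> p%:Z < 2 ^+ N.+1.
Proof.
move=> hp; have h1 : (p < 2 ^ N.+1)%N.
  have : (N.+1 < 2 ^ N.+1)%N by apply: ltn_expl.
  by apply: leq_ltn_trans; apply: leqW.
by move: h1; rewrite -ltz_nat -[X in _ < X -> _]natz natrX natz.
Qed.

End Input.

(** * The program and its correctness *)

Opaque job_field res_field.
Arguments upd _ _ _ _ _ _ /.

(* Costs are brought to a common denominator. *)
Definition init_costs : stmt :=
  For vX mE (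
    SetReg vT1 (rnum vX) ;;
    For vY mE (
      If (Minus (V vX) (V vY)) (MulTo vT1 (V vT1) (rden vY))
        (If (Minus (V vY) (V vX)) (MulTo vT1 (V vT1) (rden vY)) Nop)) ;;
    Put vCOST (V vX) (V vT1)).

(** The common timeslot of the mountain is not part of the input, but the latest job start is one.
    Without jobs the value stays 0. *)
Definition init_peak : stmt :=
  SetReg vL (K 0) ;;
  For vX nE (If (Minus (jstart vX) (V vL)) (SetReg vL (jstart vX)) Nop) ;;
  SetReg vR (V vL).

Definition when_active (lo : sexpr) (t : nat) (hi : sexpr) (p : stmt) : stmt :=
  If (Minus lo (V t)) Nop (If (Minus (V t) hi) Nop p).

Lemma triple_active N lo t hi p W (a b tv : nat) Q :
  safe W lo -> safe W hi -> seval W lo = a%:Z -> seval W hi = b%:Z ->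
  (t <= 64)%N -> W t 0%N = tv%:Z ->
  ((a <= tv <= b)%N -> triple N p W Q) -> (~~ (a <= tv <= b)%N -> Q W) ->
  triple N (when_active lo t hi p) W Q.
Proof.
move=> s1 s2 e1 e2 ht et hyes hno; apply: triple_if; rewrite /= ?s1 ?s2 ?ht //= e1 et => h1.
  by apply: triple_nop; apply: hno; lia.
apply: triple_if; rewrite /= ?s1 ?s2 ?ht //= e2 et => h2.
  by apply: triple_nop; apply: hno; lia.
by apply: hyes; lia.
Qed.

Lemma sum_upto (R : nmodType) k x (P : pred 'I_k) (F : 'I_k -> R) (hx : (x < k)%N) :
  \sum_(i : 'I_k | (i < x.+1)%N && P i) F i =
  \sum_(i : 'I_k | (i < x)%N && P i) F i + (if P (Ordinal hx) then F (Ordinal hx) else 0).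
Proof.
have eqx (i : 'I_k) : (i == Ordinal hx) = (i == x :> nat) by [].
rewrite (bigID (fun i => i == Ordinal hx)) /= addrC; congr (_ + _).
  apply: eq_bigl => i.
  by rewrite eqx ltnS [(i < x)%N]ltn_neqAle; case: (i <= x)%N; case: eqP; case: (P i).
rewrite big_mkcond (bigD1 (Ordinal hx)) //= eqxx ltnSn /= andbT big1 ?addr0 //.
by move=> i /negbTE ->; rewrite !andbF.
Qed.

(** * Correctness of the preprocessing *)

Section Preprocessing.

Variable I : instance.

Notation n := (njobs I).
Notation m := (nresources I).
Notation N := (input_size I).
Implicit Types (i : 'I_(nresources I)) (j : 'I_(njobs I)).

Lemma jstart_ok W x j : input_ok I W -> W x 0%N = Posz j -> (x <= 64)%N ->
  safe W (jstart x) * (seval W (jstart x) = (job_start j)%:Z).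
Proof. by move=> h1 h2 h3; have [] := job_field_ok h1 h2 h3 (isT : (0 < 2)%N). Qed.

Lemma jend_ok W x j : input_ok I W -> W x 0%N = Posz j -> (x <= 64)%N ->
  safe W (jend x) * (seval W (jend x) = (job_end j)%:Z).
Proof. by move=> h1 h2 h3; have [] := job_field_ok h1 h2 h3 (isT : (1 < 2)%N). Qed.

Lemma rstart_ok W x i : input_ok I W -> W x 0%N = Posz i -> (x <= 64)%N ->
  safe W (rstart x) * (seval W (rstart x) = (res_start i)%:Z).
Proof. by move=> h1 h2 h3; have [] := res_field_ok h1 h2 h3 (isT : (0 < 5)%N). Qed.

Lemma rend_ok W x i : input_ok I W -> W x 0%N = Posz i -> (x <= 64)%N ->
  safe W (rend x) * (seval W (rend x) = (res_end i)%:Z).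
Proof. by move=> h1 h2 h3; have [] := res_field_ok h1 h2 h3 (isT : (1 < 5)%N). Qed.

Lemma rcap_ok W x i : input_ok I W -> W x 0%N = Posz i -> (x <= 64)%N ->
  safe W (rcap x) * (seval W (rcap x) = capacity i).
Proof. by move=> h1 h2 h3; have [] := res_field_ok h1 h2 h3 (isT : (2 < 5)%N). Qed.

Lemma rnum_ok W x i : input_ok I W -> W x 0%N = Posz i -> (x <= 64)%N ->
  safe W (rnum x) * (seval W (rnum x) = numq (res_cost i)).
Proof. by move=> h1 h2 h3; have [] := res_field_ok h1 h2 h3 (isT : (3 < 5)%N). Qed.

Lemma rden_ok W x i : input_ok I W -> W x 0%N = Posz i -> (x <= 64)%N ->
  safe W (rden x) * (seval W (rden x) = denq (res_cost i)).
Proof. by move=> h1 h2 h3; have [] := res_field_ok h1 h2 h3 (isT : (4 < 5)%N). Qed.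

Lemma input_ok_off S W W' : same_off S W W' -> 0%N \notin S -> input_ok I W -> input_ok I W'.
Proof. by move=> h1 h2 h3 p; rewrite h1. Qed.

Lemma bound_n W S : input_ok I W -> 0%N \notin S ->
  forall W', same_off S W W' -> safe W' nE /\ seval W' nE = n%:Z.
Proof. by move=> hin h0 W' /(_ 0%N 2%N h0) h; split; rewrite //= h hin. Qed.

Lemma bound_m W S : input_ok I W -> 0%N \notin S ->
  forall W', same_off S W W' -> safe W' mE /\ seval W' mE = m%:Z.
Proof. by move=> hin h0 W' /(_ 0%N 3%N h0) h; split; rewrite //= h hin. Qed.

(** With the product of all denominators as common denominator, each numerator is multiplied by the
    denominators of the other resources. The partial product is the long factor and each denominator
    the multiplier; two strict comparisons stand for the test that the indices differ. *)
Lemma triple_init_costs W (Q : store -> Prop) : input_ok I W ->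
  (forall W', same_off [:: vX; vY; vT1; vCOST; vMA; vMB; vMR; vMH] W W' ->
     (forall i, W' vCOST i = numq (res_cost i) * \prod_(i' | i' != i) denq (res_cost i')) ->
     Q W') -> triple N init_costs W Q.
Proof.
move=> hin hQ.
pose S := [:: vY; vT1; vCOST; vMA; vMB; vMR; vMH].
pose c i := numq (res_cost i) * \prod_(i' | i' != i) denq (res_cost i').
apply: (@triple_for N vX _ _ W m S (fun x W' => forall i, (i < x)%N -> W' vCOST i = c i)) => //.
- exact: nresources_le_size.
- exact: bound_m.
- move=> x W1 hx hW1 hx1 hinv; pose i := Ordinal hx.
  have hin1 : input_ok I W1 by apply: input_ok_off hW1 _ hin.
  have [s1 e1] := @rnum_ok W1 vX i hin1 hx1 isT.
  apply: triple_then; apply: triple_set => //; rewrite e1.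
  apply: triple_then.
  set W2 := upd _ _ _ _.
  pose Inv y (W' : store) := W' vT1 0%N = numq (res_cost i)
     * \prod_(i' : 'I_m | (i' < y)%N && (i' != i)) denq (res_cost i').
  apply: (@triple_for N vY _ _ W2 m [:: vT1; vMA; vMB; vMR; vMH] Inv) => //.
  + exact: nresources_le_size.
  + exact: bound_m.
  + by rewrite /Inv big_pred0_eq /= mulr1.
  + move=> y W3 hy hW3 hy3 hinv3; pose i' := Ordinal hy.
    have hin3 : input_ok I W3 by apply: input_ok_off hW3 _ hin1.
    have hx3 : W3 vX 0%N = Posz x by rewrite hW3.
    have [s3 e3] := @rden_ok W3 vY i' hin3 hy3 isT.
    have e4 v : safe (upd W3 vMA 0 v) (rden vY) * (seval (upd W3 vMA 0 v) (rden vY) = denq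
      (res_cost i')).
      by apply: rden_ok.
    have step : i' != i -> triple N (MulTo vT1 (V vT1) (rden vY)) W3
        (fun W2 => same_off [:: vT1; vMA; vMB; vMR; vMH] W3 W2 /\
                   Inv y.+1 (upd W2 vY 0%N (Posz y.+1))).
      move=> hne; apply: triple_mul => //.
      * by rewrite e3 denq_lt ltW // denq_gt0.
      * move=> W4 h4 h5; split => //; rewrite /Inv /= h5 e3 /= hinv3 -mulrA; congr (_ * _).
        rewrite [RHS](bigD1 i') /= ?ltnSn // mulrC; congr (_ * _).
        apply: eq_bigl => z; rewrite ltnS -[z == i']/(z == y :> nat) [(z < y)%N]ltn_neqAle.
        by case: (z == y :> nat); case: (z <= y)%N; case: (z != i).
    apply: triple_if => //=; rewrite hx3 hy3 => h1.
      by apply: step; rewrite -val_eqE /=; lia.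
    apply: triple_if => //=; rewrite hx3 hy3 => h2.
      by apply: step; rewrite -val_eqE /=; lia.
    apply: triple_nop; split => //; rewrite /Inv /= hinv3; congr (_ * _).
    have hxy : x = y by lia.
    apply: eq_bigl => z; rewrite ltnS [(z < y)%N]ltn_neqAle.
    rewrite -[z == i]/(z == x :> nat) hxy.
    by case: (z == y :> nat); case: (z <= y)%N.
  + move=> W3 hW3 hinv3; have hx3 : W3 vX 0%N = Posz x by rewrite hW3.
    apply: triple_put => //=; rewrite hx3 //=; split.
      apply: same_off_upd => //; apply: (@same_off_trans _ _ W2).
        exact: same_off_upd.
      by apply: same_off_sub hW3; apply/allP.
    move=> i0 hi0 /=; case: eqP => /= [E|hne]; last first.
      by rewrite hW3 //=; apply: hinv; rewrite ltnS leq_eqVlt in hi0; case/orP: hi0 => // /eqP.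
    rewrite hinv3 /c; have -> : i0 = i by apply: val_inj.
    by congr (_ * _); apply: eq_bigl => z; rewrite ltn_ord.
- move=> W1 hW1 hinv; apply: hQ; first by apply: same_off_sub hW1; apply/allP.
  by move=> i; apply: hinv.
Qed.

Lemma triple_init_peak W (Q : store -> Prop) : input_ok I W -> single_mountain I ->
  (forall W' (t0 : nat), same_off [:: vX; vL; vR] W W' ->
     W' vL 0%N = t0 -> W' vR 0%N = t0 ->
     (forall j, (job_start j <= t0 <= job_end j)%N) -> Q W') ->
  triple N init_peak W Q.
Proof.
move=> hin [t ht hmt] hQ.
apply: triple_then; apply: triple_set => //; apply: triple_then.
set W1 := upd _ _ _ _.
pose Inv x (W' : store) := exists l : nat, [/\ W' vL 0%N = l,
  forall j, (j < x)%N -> (job_start j <= l)%N & l = 0%N \/ exists j, l = job_start j].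
apply: (@triple_for N vX _ _ W1 n [:: vL] Inv) => //.
- exact: njobs_le_size.
- exact: bound_n.
- by exists 0%N; split => //; left.
- move=> x W2 hx hW2 hx2 [l [hl h1 h2]]; pose j := Ordinal hx.
  have hin2 : input_ok I W2 by apply: input_ok_off hW2 _ hin.
  have [s e] := @jstart_ok W2 vX j hin2 hx2 isT.
  apply: triple_if; first by rewrite /= s.
  + rewrite /= e hl => hlt; apply: triple_set => //; split; first exact: same_off_upd.
    exists (job_start j); split; [by rewrite /= e | | by right; exists j].
    move=> j' hj'; case: (ltnP j' x) => hj2; first by apply: leq_trans (h1 _ hj2) _; lia.
    by have -> : j' = j by apply: val_inj => /=; lia.
  + rewrite /= e hl => hlt; apply: triple_nop; split => //; exists l; split => //.
    move=> j' hj'; case: (ltnP j' x) => hj2; first exact: h1.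
    have -> : j' = j by apply: val_inj => /=; lia.
    by lia.
- move=> W2 hW2 [l [hl h1 h2]]; apply: triple_set => //; apply: (hQ _ l) => //.
  + apply: same_off_upd => //; apply: (@same_off_trans _ _ W1); first exact: same_off_upd.
    by apply: same_off_sub hW2; apply/allP.
  + move=> j; rewrite h1 //=; case: h2 => [l0|[j' ->]].
      by have := h1 j (ltn_ord j); have := job_wf j; lia.
    have := hmt j (in_setT _); have := hmt j' (in_setT _); rewrite /job_active; lia.
Qed.

End Preprocessing.

(** * The outward scan as a program *)

Definition add_weight (t : nat) : stmt :=
  when_active (rstart vX) t (rend vX) (SetReg vT1 (Plus (V vT1) (V vT2))).

Definition compute_weight : stmt :=
  SetReg vT1 (K 0) ;;
  If (rcap vX)
    (SetReg vT2 (rcap vX) ;;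
     If (Minus (V vT2) (V vG)) (SetReg vT2 (V vG)) Nop ;;
     add_weight vL ;;
     add_weight vR) Nop ;;
  Put vWEIGHT (V vX) (V vT1).

(** Ratios of residual cost to weight are compared by cross-multiplication, with the weights as
    multipliers. On entry [vT1] holds the weight of the current resource. *)
Definition compare_best : stmt :=
  If (V vT1)
    (If (V vFOUND)
       (MulTo vT2 (A vCOST (V vX)) (A vWEIGHT (V vBEST)) ;;
        MulTo vT1 (A vCOST (V vBEST)) (A vWEIGHT (V vX)) ;;
        If (Minus (V vT1) (V vT2)) (SetReg vBEST (V vX)) Nop)
       (SetReg vFOUND (K 1) ;; SetReg vBEST (V vX)))
    Nop.

Definition scan : stmt :=
  SetReg vG (Minus kE (V vCNT)) ;;
  SetReg vFOUND (K 0) ;;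
  For vX mE (compute_weight ;; compare_best).

(* Costs are rescaled by the weight of the best resource, which keeps them integral. *)
Definition pay : stmt :=
  SetReg vWB (A vWEIGHT (V vBEST)) ;;
  SetReg vCB (A vCOST (V vBEST)) ;;
  For vX mE (
    MulTo vT1 (A vCOST (V vX)) (V vWB) ;;
    MulTo vT2 (V vCB) (A vWEIGHT (V vX)) ;;
    Put vCOST (V vX) (Minus (V vT1) (V vT2))).

Definition push : stmt :=
  Put vORDER (V vSIZE) (V vBEST) ;;
  SetReg vSIZE (Plus (V vSIZE) (K 1)) ;;
  If (Minus (V vL) (Minus (rstart vBEST) (K 1)))
     (SetReg vL (Minus (rstart vBEST) (K 1))) Nop ;;
  If (Minus (Plus (rend vBEST) (K 1)) (V vR))
     (SetReg vR (Plus (rend vBEST) (K 1))) Nop.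

Definition choose_jobs : stmt :=
  For vX nE
    (If (A vJOB (V vX)) Nop
      (If (Minus (jstart vX) (V vL))
        (If (Minus (V vR) (jend vX))
          (If (Minus kE (V vCNT))
            (Put vJOB (V vX) (K 1) ;; SetReg vCNT (Plus (V vCNT) (K 1)))
            Nop) Nop) Nop)).

(** Every productive round frees a new resource, so as many rounds as there are resources suffice;
    the others do not change the state of the scan. *)
Definition main_loop : stmt :=
  For vU mE
    (If (Minus kE (V vCNT))
      (scan ;; If (V vFOUND) (pay ;; push ;; choose_jobs) Nop) Nop).

Section MainLoop.

Variable I : instance.

Notation n := (njobs I).
Notation m := (nresources I).
Notation N := (input_size I).
Implicit Types (i : 'I_(nresources I)) (j : 'I_(njobs I)).
Implicit Types (J : {set 'I_(njobs I)}) (ord : seq 'I_(nresources I)).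

Lemma triple_add_weight t W i (u acc : int) (tv : nat) (Q : store -> Prop) :
  input_ok I W -> W vX 0%N = Posz i -> W vT1 0%N = acc -> W vT2 0%N = u ->
  (t <= 64)%N -> W t 0%N = tv ->
  (forall W', same_off [:: vT1] W W' ->
     W' vT1 0%N = acc + u * (res_active i tv)%:Z -> Q W') ->
  triple N (add_weight t) W Q.
Proof.
move=> hin hx h1 h2 ht htv hQ.
have [s1 e1] := @rstart_ok I W vX i hin hx isT.
have [s2 e2] := @rend_ok I W vX i hin hx isT.
apply: (@triple_active _ _ _ _ _ _ (res_start i) (res_end i) tv) => // ha.
  apply: triple_set => //; apply: hQ; first exact: same_off_upd.
  by rewrite /= h1 h2 /res_active ha mulr1.
by apply: hQ => //; rewrite h1 /res_active (negbTE ha) mulr0 addr0.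
Qed.

Lemma triple_compute_weight W i (l r : nat) g (Q : store -> Prop) :
  input_ok I W -> W vX 0%N = Posz i -> W vL 0%N = l -> W vR 0%N = r ->
  W vG 0%N = g -> 
  (forall W', same_off [:: vT1; vT2; vWEIGHT] W W' ->
     (forall y, W' vWEIGHT y = if y == i then weight l r g i else W vWEIGHT y) ->
     W' vT1 0%N = weight l r g i -> Q W') ->
  triple N compute_weight W Q.
Proof.
move=> hin hx hl hr hg hQ.
have final W1 : same_off [:: vT1; vT2] W W1 -> W1 vT1 0%N = weight l r g i ->
    triple N (Put vWEIGHT (V vX) (V vT1)) W1 Q.
  move=> h1 h2; have hx1 : W1 vX 0%N = Posz i by rewrite h1.
  apply: triple_put => //=; rewrite ?hx1 //=; apply: hQ => /=; last by [].
    by apply: same_off_upd => //; apply: same_off_sub h1; apply/allP.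
  by move=> y; rewrite h2; case: eqP => // _; rewrite h1.
apply: triple_then; apply: triple_set => //; apply: triple_then.
set W1 := upd _ _ _ _.
have hW1 : same_off [:: vT1; vT2] W W1 by apply: same_off_upd.
have [s1 e1] := @rcap_ok I W1 vX i hin hx isT.
apply: triple_if => //; rewrite e1 => hcap; last first.
  apply: triple_nop; apply: final => //.
  by rewrite /weight /unit_weight ltNge hcap !mul0r.
apply: triple_then; apply: triple_set => //; rewrite e1.
set W2 := upd _ _ _ _; have hW2 : same_off [:: vT1; vT2] W W2 by apply: same_off_upd.
apply: triple_then.
have rest W3 : same_off [:: vT1; vT2] W W3 -> W3 vT1 0%N = 0 ->
    W3 vT2 0%N = unit_weight g i -> triple N (add_weight vL ;; add_weight vR) W3
    (fun W1 => triple N (Put vWEIGHT (V vX) (V vT1)) W1 Q).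
  move=> h3 h4 h5; apply: triple_then.
  apply: (@triple_add_weight _ _ i (unit_weight g i) 0 l) => //.
  - by apply: input_ok_off h3 _ hin.
  - by rewrite h3.
  - by rewrite h3.
  move=> W4 h6 h7; have h8 := same_off_trans h3 (same_off_sub (_ : {subset [:: vT1] <= [:: vT1;
    vT2]}) h6).
  have {}h8 : same_off [:: vT1; vT2] W W4 by apply: h8; apply/allP.
  apply: (@triple_add_weight _ _ i (unit_weight g i) (unit_weight g i * (res_active i l)%:Z) r)
    => //.
  - by apply: input_ok_off h8 _ hin.
  - by rewrite h8.
  - by rewrite h7 add0r.
  - by rewrite h6.
  - by rewrite h8.
  move=> W5 h9 h10; apply: final => //.
  by apply: same_off_trans h8 _; apply: same_off_sub h9; apply/allP.
have hg2 : W2 vG 0%N = g by [].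
have ht2 : W2 vT2 0%N = capacity i by [].
apply: triple_if => //=; rewrite hg2 ht2 => hcmp.
  apply: triple_set => //=; apply: rest => //=; first exact: same_off_upd.
  by rewrite /unit_weight hcap hg2; case: leP hcmp => //; lia.
apply: triple_nop; apply: rest => //=.
by rewrite /unit_weight hcap; case: leP hcmp => //; lia.
Qed.

Lemma weight_lt l r (g : int) i : 0 <= g -> g <= partiality I ->
  0 <= weight l r g i < 2 ^+ N.+1.
Proof.
move=> g0 gk; rewrite weight_ge0 //=.
apply: le_lt_trans (partiality_lt I).
have hu : unit_weight g i <= g.
  by rewrite /unit_weight; case: ifP => // _; rewrite ge_min lexx orbT.
have hu0 := unit_weight_ge0 i g0.
by rewrite /weight; case: (res_active i l); case: (res_active i r); rewrite ?mulr1 ?mulr0; lia.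
Qed.

Definition best_of (w cur : 'I_m -> int) (x : nat) (W : store) : Prop :=
  (W vFOUND 0%N = 0 /\ forall i, (i < x)%N -> w i <= 0) \/
  (exists b : 'I_m, [/\ (b < x)%N, W vFOUND 0%N = 1, W vBEST 0%N = Posz b, 0 < w b &
     forall i, (i < x)%N -> 0 < w i -> cur b * w i <= cur i * w b]).

Lemma triple_compare_best W x (hx : (x < m)%N) (w cur : 'I_m -> int) (Q : store -> Prop) :
  input_ok I W -> W vX 0%N = Posz x -> W vT1 0%N = w (Ordinal hx) ->
  (forall i, 0 <= w i < 2 ^+ N.+1) ->
  (forall i, W vCOST i = cur i) -> (forall i, (i <= x)%N -> W vWEIGHT i = w i) ->
  best_of w cur x W ->
  (forall W', same_off [:: vT1; vT2; vFOUND; vBEST; vMA; vMB; vMR; vMH] W W' ->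
     best_of w cur x.+1 W' -> Q W') ->
  triple N compare_best W Q.
Proof.
move=> hin hx1 ht1 hw hcost hweight hbest hQ.
have split_lt i : (i < x.+1)%N -> (i < x)%N \/ i = Ordinal hx.
  by rewrite ltnS leq_eqVlt => /orP[/eqP h|]; [right; apply: val_inj|left].
apply: triple_if => //=; rewrite ht1 => hw1; last first.
  apply: triple_nop; apply: hQ => //; case: hbest => [[h1 h2]|[b [h1 h2 h3 h4 h5]]].
    by left; split => // i /split_lt[/h2|->].
  right; exists b; split => //; first by rewrite ltnS ltnW.
  by move=> i /split_lt[/h5|-> h] //; lia.
apply: triple_if => //=; case: hbest => [[h1 h2]|[b [h1 h2 h3 h4 h5]]]; rewrite ?h1 ?h2 //= => _.
- apply: triple_then; apply: triple_mul => //=.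
  + by rewrite hx1.
  + by move=> v; rewrite h3.
  + by rewrite h3 /= (hweight b (ltnW h1)) hw.
  rewrite hx1 h3 /= (hcost (Ordinal hx)) (hweight b (ltnW h1)) => W1 hW1 hm1.
  apply: triple_then; apply: triple_mul => //=.
  + by rewrite hW1 // h3.
  + by move=> v; rewrite hW1 // hx1.
  + by rewrite !hW1 // hx1 /= (hweight (Ordinal hx)) // hw.
  rewrite !hW1 // h3 hx1 /= (hcost b) (hweight (Ordinal hx)) // => W2 hW2 hm2.
  have hoff : same_off [:: vT1; vT2; vFOUND; vBEST; vMA; vMB; vMR; vMH] W W2.
    apply: (@same_off_trans _ _ W1); first by apply: same_off_sub hW1; apply/allP.
    by apply: same_off_sub hW2; apply/allP.
  apply: triple_if => //=; rewrite hm2 hW2 // hm1 => hcmp.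
    apply: triple_set => //; apply: hQ; first exact: same_off_upd.
    right; exists (Ordinal hx); split => //=.
    + by rewrite hW2 // hW1.
    + by rewrite hW2 // hW1.
    move=> i /split_lt[hi hwi|-> //]; have h6 := h5 _ hi hwi.
    (* Transitivity of the comparison of ratios, obtained after multiplying by the positive weight
       of the former best. *)
    rewrite -(ler_pM2r h4); move: (w i) (w b) (w _) (cur i) (cur b) (cur _) hwi h4 hw1 h6 hcmp.
    by move=> wi wb wx ci cb cx *; nia.
  apply: triple_nop; apply: hQ => //; right; exists b; split => //.
  + by rewrite ltnS ltnW.
  + by rewrite hW2 // hW1.
  + by rewrite hW2 // hW1.
  by move=> i /split_lt[/h5|->] //; lia.
- apply: triple_then; apply: triple_set => //; apply: triple_set => //=.
  rewrite hx1; apply: hQ; first by repeat apply: same_off_upd.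
  right; exists (Ordinal hx); split => //= i /split_lt[/h2|-> //]; lia.
Qed.

Lemma triple_scan W (l r cnt : nat) (cur : 'I_m -> int) (Q : store -> Prop)
    (g := partiality I - cnt%:Z) (w := weight l r g) :
  input_ok I W -> W vL 0%N = l -> W vR 0%N = r -> W vCNT 0%N = cnt -> 0 < g ->
  (forall i, W vCOST i = cur i) ->
  (forall W', same_off [:: vX; vT1; vT2; vG; vWEIGHT; vFOUND; vBEST; vMA; vMB; vMR; vMH] W W' ->
     (forall i, W' vWEIGHT i = w i) -> best_of w cur m W' -> Q W') ->
  triple N scan W Q.
Proof.
move=> hin hl hr hcnt g0 hcost hQ.
have hk : W 0%N 1%N = partiality I by rewrite hin; have [] := encode_head I.
apply: triple_then; apply: triple_set => //=; rewrite hk hcnt -/g.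
apply: triple_then; apply: triple_set => //=.
set W1 := upd _ _ _ _.
pose S := [:: vT1; vT2; vWEIGHT; vFOUND; vBEST; vMA; vMB; vMR; vMH].
apply: (@triple_for N vX _ _ W1 m S (fun x W' =>
  (forall i, (i < x)%N -> W' vWEIGHT i = w i) /\ best_of w cur x W')) => //.
- exact: nresources_le_size.
- exact: bound_m.
- by split => //; left.
- move=> x W2 hx hW2 hx2 [hw2 hb2]; pose i := Ordinal hx.
  have hin2 : input_ok I W2 by apply: input_ok_off hW2 _ hin.
  apply: triple_then; apply: (@triple_compute_weight _ i l r g) => //; try by rewrite hW2.
  move=> W3 hW3 hw3 ht3.
  have hin3 : input_ok I W3 by apply: input_ok_off hW3 _ hin2.
  apply: (@triple_compare_best _ x hx w cur) => //.
  + by rewrite hW3.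
  + by move=> i'; apply: weight_lt; [exact: ltW|rewrite /g; lia].
  + by move=> i'; rewrite hW3 // hW2 //; apply: hcost.
  + move=> i' hi'; rewrite hw3; case: eqP => [/val_inj -> //|hne].
    apply: hw2; rewrite ltn_neqAle hi' andbT; exact/eqP.
  + case: hb2 => [[h1 h2]|[b [h1 h2 h3 h4 h5]]]; [left|right; exists b]; split => //;
    by rewrite hW3.
  move=> W4 hW4 hb4; split.
    apply: (@same_off_trans _ _ W3); first by apply: same_off_sub hW3; apply/allP.
    by apply: same_off_sub hW4; apply/allP.
  split => // i' hi' /=; rewrite hW4 // hw3; case: eqP => [/val_inj -> //|hne].
  by apply: hw2; rewrite ltnS leq_eqVlt in hi'; case/orP: hi' => // /eqP.
- move=> W2 hW2 [hw2 hb2]; apply: hQ => //.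
  + apply: (@same_off_trans _ _ W1); first by repeat apply: same_off_upd.
    by apply: same_off_sub hW2; apply/allP.
  + by move=> i; apply: hw2.
Qed.

Lemma triple_pay W (b : 'I_m) (cur w : 'I_m -> int) (Q : store -> Prop) :
  input_ok I W -> W vBEST 0%N = Posz b ->
  (forall i, W vCOST i = cur i) -> (forall i, W vWEIGHT i = w i) ->
  (forall i, 0 <= w i < 2 ^+ N.+1) ->
  (forall W', same_off [:: vX; vT1; vT2; vWB; vCB; vCOST; vMA; vMB; vMR; vMH] W W' ->
     (forall i, W' vCOST i = cur i * w b - cur b * w i) -> Q W') ->
  triple N pay W Q.
Proof.
move=> hin hb hcost hweight hw hQ.
apply: triple_then; apply: triple_set => //=; first by rewrite hb.
rewrite hb /= hweight.
apply: triple_then; apply: triple_set => //=; first by rewrite hb.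
rewrite hb /= hcost; set W1 := upd _ _ _ _.
pose S := [:: vT1; vT2; vCOST; vMA; vMB; vMR; vMH].
apply: (@triple_for N vX _ _ W1 m S (fun x W' => forall i,
   W' vCOST i = if (i < x)%N then cur i * w b - cur b * w i else cur i)) => //.
- exact: nresources_le_size.
- exact: bound_m.
- move=> x W2 hx hW2 hx2 hinv; pose i := Ordinal hx.
  have hwb2 : W2 vWB 0%N = w b by rewrite hW2.
  have hcb2 : W2 vCB 0%N = cur b by rewrite hW2.
  have hw2 : W2 vWEIGHT x = w i by rewrite hW2 //; apply: (hweight i).
  apply: triple_then; apply: triple_mul => //=.
  + by rewrite hx2.
  + by rewrite hwb2 hw.
  rewrite hx2 hwb2 /= (hinv i) ltnn => W3 hW3 hm3.
  apply: triple_then; apply: triple_mul => //=.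
  + by move=> v; rewrite hW3 // hx2.
  + by rewrite !hW3 // hx2 /= hw2 hw.
  rewrite !hW3 // hx2 /= hw2 hcb2 => W4 hW4 hm4.
  have hx4 : W4 vX 0%N = Posz x by rewrite hW4 // hW3.
  apply: triple_put => //=; rewrite hx4 //= hm4 hW4 // hm3; split.
    apply: same_off_upd => //; apply: (@same_off_trans _ _ W3).
      by apply: same_off_sub hW3; apply/allP.
    by apply: same_off_sub hW4; apply/allP.
  move=> i' /=; case: eqP => [/= E|hne].
    by have -> : i' = i by [apply: val_inj]; rewrite ltnSn.
  rewrite hW4 // hW3 // hinv ltnS [(i' <= x)%N]leq_eqVlt; by rewrite (introF eqP hne).
- move=> W2 hW2 hinv; apply: hQ.
  + apply: (@same_off_trans _ _ W1); first by repeat apply: same_off_upd.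
    by apply: same_off_sub hW2; apply/allP.
  + by move=> i; rewrite hinv ltn_ord.
Qed.

Lemma triple_push W (b : 'I_m) (l r s : nat) (Q : store -> Prop) :
  input_ok I W -> W vBEST 0%N = Posz b -> W vL 0%N = l -> W vR 0%N = r ->
  W vSIZE 0%N = s ->
  (forall W', same_off [:: vORDER; vSIZE; vL; vR] W W' ->
     (forall p, W' vORDER p = if p == s then Posz b else W vORDER p) ->
     W' vSIZE 0%N = s.+1 -> W' vL 0%N = minn l (res_start b).-1 ->
     W' vR 0%N = maxn r (res_end b).+1 -> Q W') ->
  triple N push W Q.
Proof.
move=> hin hb hl hr hs hQ.
apply: triple_then; apply: triple_put => //=; rewrite ?hs ?hb //=.
apply: triple_then; apply: triple_set => //=; rewrite hs.
set W1 := upd _ _ _ _.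
have [s1 e1] := @rstart_ok I W1 vBEST b hin hb isT.
have hwf := res_wf b; have hl1 : W1 vL 0%N = l by [].
have last_if W2 : same_off [:: vL] W1 W2 -> W2 vL 0%N = minn l (res_start b).-1 ->
    triple N (If (Minus (Plus (rend vBEST) (K 1)) (V vR))
     (SetReg vR (Plus (rend vBEST) (K 1))) Nop) W2 Q.
  move=> hW2 hl2.
  have hin2 : input_ok I W2 by apply: input_ok_off hW2 _ hin.
  have hb2 : W2 vBEST 0%N = Posz b by rewrite hW2.
  have hr2 : W2 vR 0%N = r by rewrite hW2.
  have [s2 e2] := @rend_ok I W2 vBEST b hin2 hb2 isT.
  have hoff : same_off [:: vORDER; vSIZE; vL; vR] W W2.
    apply: (@same_off_trans _ _ W1); first by repeat apply: same_off_upd.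
    by apply: same_off_sub hW2; apply/allP.
  have hord p : W2 vORDER p = if p == s then Posz b else W vORDER p by rewrite hW2.
  have hsz : W2 vSIZE 0%N = s.+1 by rewrite hW2 // /W1 /=; lia.
  apply: triple_if; first by rewrite /= s2.
  - rewrite /= e2 hr2 => hcmp; apply: triple_set; rewrite //= ?s2 //.
    apply: hQ => //=; first exact: same_off_upd.
    by rewrite e2; lia.
  - rewrite /= e2 hr2 => hcmp; apply: triple_nop; apply: hQ => //=.
    by rewrite hr2; lia.
apply: triple_then; apply: triple_if; first by rewrite /= s1.
- rewrite /= e1 hl1 => hcmp.
  apply: triple_set; rewrite //= ?s1 //; apply: last_if; first exact: same_off_upd.
  by rewrite /= e1; lia.
- rewrite /= e1 hl1 => hcmp; apply: triple_nop; apply: last_if => //.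
  by rewrite hl1; lia.
Qed.

Lemma triple_choose_jobs W (l r : nat) J (Q : store -> Prop) :
  input_ok I W -> W vL 0%N = l -> W vR 0%N = r -> W vCNT 0%N = #|J| ->
  (forall j, W vJOB j = (j \in J)%:Z) -> #|J|%:Z <= partiality I ->
  J \subset inside I l r ->
  (forall W' J', same_off [:: vX; vJOB; vCNT] W W' ->
     (forall j, W' vJOB j = (j \in J')%:Z) -> W' vCNT 0%N = #|J'| ->
     J \subset J' -> J' \subset inside I l r -> #|J'|%:Z <= partiality I ->
     (#|J'|%:Z < partiality I -> J' = inside I l r) -> Q W') ->
  triple N choose_jobs W Q.
Proof.
move=> hin hl hr hcnt hjob hk hJ hQ.
pose Inv x (W' : store) := exists J', [/\ forall j, W' vJOB j = (j \in J')%:Z,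
  W' vCNT 0%N = #|J'|, J \subset J' /\ J' \subset inside I l r, #|J'|%:Z <= partiality I &
  #|J'|%:Z < partiality I -> forall j, (j < x)%N -> j \in inside I l r -> j \in J'].
apply: (@triple_for N vX _ _ W n [:: vJOB; vCNT] Inv) => //.
- exact: njobs_le_size.
- exact: bound_n.
- by exists J; split.
- move=> x W1 hx hW1 hx1 [J1 [hj1 hc1 [hs1 hs2] hk1 hall]]; pose j := Ordinal hx.
  have hin1 : input_ok I W1 by apply: input_ok_off hW1 _ hin.
  have [s1 e1] := @jstart_ok I W1 vX j hin1 hx1 isT.
  have [s2 e2] := @jend_ok I W1 vX j hin1 hx1 isT.
  have hl1 : W1 vL 0%N = l by rewrite hW1.
  have hr1 : W1 vR 0%N = r by rewrite hW1.
  have hkE : W1 0%N 1%N = partiality I by rewrite hin1; have [] := encode_head I.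
  have skip : (#|J1|%:Z < partiality I -> j \in inside I l r -> j \in J1) ->
      same_off [:: vJOB; vCNT] W1 W1 /\ Inv x.+1 (upd W1 vX 0%N (Posz x.+1)).
    move=> hj; split => //; exists J1; split => // hlt j' hj'.
    case: (ltnP j' x) => h; first exact: hall.
    by have -> : j' = j by [apply: val_inj => /=; lia]; apply: hj.
  apply: triple_if; rewrite /= ?hx1 //= (hj1 j) => h1.
    by apply: triple_nop; apply: skip; case: (j \in J1) h1.
  apply: triple_if; rewrite /= ?s1 //= e1 hl1 => h2; last first.
    by apply: triple_nop; apply: skip; rewrite inE; lia.
  apply: triple_if; rewrite /= ?s2 //= e2 hr1 => h3; last first.
    by apply: triple_nop; apply: skip; rewrite inE; lia.
  apply: triple_if; rewrite //= hkE hc1 => h4; last first.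
    by apply: triple_nop; apply: skip; lia.
  have hjJ : j \notin J1 by case: (j \in J1) h1.
  have hcard : #|j |: J1| = #|J1|.+1 by rewrite cardsU1 hjJ.
  apply: triple_then; apply: triple_put; rewrite //= ?hx1 //=.
  apply: triple_set => //=; split; first by repeat apply: same_off_upd.
  exists (j |: J1); split => /=.
  + move=> j'; rewrite !inE hj1; case: eqP => [E|hne].
      by rewrite [j' == j](introT eqP) //; apply: val_inj.
    by rewrite [j' == j](introF eqP) // => E; apply: hne; rewrite E.
  + by rewrite hc1 hcard; lia.
  + split; first by apply: subset_trans hs1 _; apply: subsetUr.
    by rewrite subUset hs2 andbT sub1set inE; lia.
  + by rewrite hcard; lia.
  + move=> hlt j' hj' hin'; rewrite in_setU1.
    case: (ltnP j' x) => h; first by rewrite hall ?orbT //; lia.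
    by have -> : j' = j by [apply: val_inj => /=; lia]; rewrite eqxx.
- move=> W1 hW1 [J1 [hj1 hc1 [hs1 hs2] hk1 hall]]; apply: (hQ _ J1) => // hlt.
  apply/eqP; rewrite eqEsubset hs2; apply/subsetP => j hj.
  by apply: hall.
Qed.

Definition stores (ord : seq 'I_m) (l r : nat) J (cur : 'I_m -> int) (W : store) : Prop :=
  [/\ W vL 0%N = l /\ W vR 0%N = r, W vCNT 0%N = #|J|,
      W vSIZE 0%N = size ord /\
        (forall p, (p < size ord)%N -> W vORDER p = nth 0%N (map val ord) p),
      forall i, W vCOST i = cur i & forall j, W vJOB j = (j \in J)%:Z].

Lemma triple_main_loop W (t0 : nat) cur0 (Q : store -> Prop) :
  input_ok I W -> stores [::] t0 t0 set0 cur0 W -> state_ok t0 [::] t0 t0 set0 cur0 ->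
  (forall W' ord l r J cur, same_off [:: vU; vX; vT1; vT2; vG; vWEIGHT; vFOUND; vBEST;
       vMA; vMB; vMR; vMH; vWB; vCB; vCOST; vORDER; vSIZE; vL; vR; vJOB; vCNT] W W' ->
     stores ord l r J cur W' -> state_ok t0 ord l r J cur ->
     (#|J|%:Z < partiality I -> forall i, weight l r (partiality I - #|J|%:Z) i <= 0) ->
     Q W') -> triple N main_loop W Q.
Proof.
move=> hin hst hok hQ.
(* While jobs are missing, either every round so far has freed a new resource, or no resource has
   positive weight and the state no longer changes. *)
pose Inv x (W' : store) := exists ord l r J cur, [/\ stores ord l r J cur W',
  state_ok t0 ord l r J cur & #|J|%:Z < partiality I -> size ord = x \/
   forall i, weight l r (partiality I - #|J|%:Z) i <= 0].
pose S := [:: vX; vT1; vT2; vG; vWEIGHT; vFOUND; vBEST;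
       vMA; vMB; vMR; vMH; vWB; vCB; vCOST; vORDER; vSIZE; vL; vR; vJOB; vCNT].
apply: (@triple_for N vU _ _ W m S Inv) => //.
- exact: nresources_le_size.
- exact: bound_m.
- by exists [::], t0, t0, set0, cur0; split => //; left.
- move=> x W1 hx hW1 hx1 [ord [l [r [J [cur [hs hok1 hprog]]]]]].
  have hin1 : input_ok I W1 by apply: input_ok_off hW1 _ hin.
  have hkE : W1 0%N 1%N = partiality I by rewrite hin1; have [] := encode_head I.
  have [[hl hr] hc [hsz hord] hcost hjob] := hs.
  apply: triple_if => //=; rewrite hkE hc => hg; last first.
    apply: triple_nop; split => //; exists ord, l, r, J, cur; split => // hlt; lia.
  apply: triple_then; apply: (@triple_scan _ l r #|J| cur) => //.
  move=> W2 hW2 hw2 hb2.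
  have hs2 : same_off S W1 W2 by apply: same_off_sub hW2; apply/allP.
  apply: triple_if => //=; case: hb2 => [[h1 h2]|[b [_ h1 h3 h4 h5]]]; rewrite h1 //= => _.
    have hin2 : input_ok I W2 by apply: input_ok_off hW2 _ hin1.
    have hwlt i : 0 <= weight l r (partiality I - #|J|%:Z) i < 2 ^+ N.+1.
      by apply: weight_lt; lia.
    apply: triple_then; apply: (@triple_pay _ b cur (weight l r (partiality I - #|J|%:Z))) => //.
      by move=> i; rewrite hW2.
    move=> W3 hW3 hcost3.
    have hin3 : input_ok I W3 by apply: input_ok_off hW3 _ hin2.
    apply: triple_then; apply: (@triple_push _ b l r (size ord)) => //;
      try by rewrite hW3 // hW2.
    move=> W4 hW4 hord4 hsz4 hl4 hr4.
    have hin4 : input_ok I W4 by apply: input_ok_off hW4 _ hin3.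
    apply: (@triple_choose_jobs _ (minn l (res_start b).-1) (maxn r (res_end b).+1) J) => //.
    + by rewrite hW4 // hW3 // hW2.
    + by move=> j; rewrite hW4 // hW3 // hW2.
    + by lia.
    + apply: subset_trans (chosen_inside hok1) _.
      by apply/subsetP => j; rewrite !inE; lia.
    move=> W5 J5 hW5 hj5 hc5 hJ5 hin5 hk5 hall5; split.
      apply: same_off_trans hs2 _; apply: (@same_off_trans _ _ W3).
        by apply: same_off_sub hW3; apply/allP.
      apply: (@same_off_trans _ _ W4); first by apply: same_off_sub hW4; apply/allP.
      by apply: same_off_sub hW5; apply/allP.
    have hstep : state_ok t0 (rcons ord b) (minn l (res_start b).-1) (maxn r (res_end b).+1)
        J5 (fun i => cur i * weight l r (partiality I - #|J|%:Z) b
                     - cur b * weight l r (partiality I - #|J|%:Z) i).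
      by apply: state_step => //; move=> i hi; apply: h5.
    exists (rcons ord b), (minn l (res_start b).-1), (maxn r (res_end b).+1), J5,
      (fun i => cur i * weight l r (partiality I - #|J|%:Z) b
                     - cur b * weight l r (partiality I - #|J|%:Z) i).
    split => //.
      split => //=.
      * by rewrite !hW5.
      * rewrite size_rcons hW5 // hsz4; split => // p hp.
        rewrite hW5 // hord4 map_rcons nth_rcons size_map.
        case: eqP => [->|hne]; first by rewrite ltnn.
        have hp' : (p < size ord)%N by lia.
        by rewrite hp' hW3 // hW2 // hord.
      * by move=> i; rewrite hW5 // hW4.
    move=> _; left; rewrite size_rcons; congr _.+1.
    case: hprog => [|//|h6]; first by lia.
    by have := h6 b; lia.
  apply: triple_nop; split => //; exists ord, l, r, J, cur; split => //.
    split => /=.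
    * by rewrite !hW2.
    * by rewrite hW2.
    * by rewrite hW2 //; split => // p hp; rewrite hW2 // hord.
    * by move=> i; rewrite hW2.
    * by move=> j; rewrite hW2.
  by move=> _; right => i; apply: h2.
- move=> W1 hW1 [ord [l [r [J [cur [hs hok1 hprog]]]]]].
  apply: (hQ _ ord l r J cur) => // hlt; case: (hprog hlt) => // hsz i.
  (* If all rounds were productive, every resource is in [ord], hence strictly inside and of weight
     zero: the loop ends stuck in this case too. *)
  have hi : i \in ord.
    have [||_ ->] := @uniq_min_size _ ord (enum 'I_m) (order_uniq hok1).
    - by move=> i' _; rewrite mem_enum.
    - by rewrite size_enum_ord hsz.
    by rewrite mem_enum.
  have := order_inside hok1 hi; have := state_peak hok1; rewrite /weight /res_active => h1 h2.
  have -> : (res_start i <= l <= res_end i)%N = false by lia.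
  have -> : (res_start i <= r <= res_end i)%N = false by lia.
  by rewrite !mulr0.
Qed.

End MainLoop.

(** * Copies, coverage tests and output *)

Definition take_all : stmt :=
  For vX (V vSIZE) (
    SetReg vCUR (A vORDER (V vX)) ;;
    Put vMULT (V vCUR) (V vCNT) ;;
    MulTo vT1 (rcap vCUR) (V vCNT) ;;
    Put vLOAD (V vCUR) (V vT1)).

Definition add_load : stmt :=
  when_active (rstart vY) vT (rend vY) (SetReg vD (Plus (V vD) (A vLOAD (V vY)))).

Definition sub_job : stmt :=
  when_active (jstart vY) vT (jend vY) (SetReg vD (Minus (V vD) (A vJOB (V vY)))).

Definition check_time : stmt :=
  SetReg vD (K 0) ;;
  For vY mE add_load ;;
  For vY nE sub_job ;;
  If (Minus (K 0) (V vD)) (SetReg vBAD (K 1)) Nop.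

(** Testing every slot could take exponential time; the job starts and the slots right after
    resource ends suffice and are polynomially many. *)
Definition check : stmt :=
  SetReg vBAD (K 0) ;;
  For vX nE (SetReg vT (jstart vX) ;; check_time) ;;
  For vX mE (SetReg vT (Plus (rend vX) (K 1)) ;; check_time).

(* [vLOAD] caches the products of capacities and multiplicities. *)
Definition attempt : stmt :=
  Put vMULT (V vCUR) (Minus (A vMULT (V vCUR)) (K 1)) ;;
  Put vLOAD (V vCUR) (Minus (A vLOAD (V vCUR)) (rcap vCUR)) ;;
  check ;;
  If (V vBAD)
    (Put vMULT (V vCUR) (Plus (A vMULT (V vCUR)) (K 1)) ;;
     Put vLOAD (V vCUR) (Plus (A vLOAD (V vCUR)) (rcap vCUR)))
    Nop.

(** Each resource starts with [vCNT] copies, so [vCNT] attempts per resource are enough. No early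
    exit is needed: after one failure the later attempts fail as well and are undone. *)
Definition reverse_delete : stmt :=
  For vU (V vSIZE) (
    SetReg vCUR (A vORDER (Minus (Minus (V vSIZE) (K 1)) (V vU))) ;;
    For vZ (V vCNT) attempt).

(** The output overwrites the input, including the cells that hold the two counts, so these are
    saved beforehand. *)
Definition write_output : stmt :=
  SetReg vN nE ;;
  SetReg vM mE ;;
  For vX (V vN) (Put 0 (V vX) (A vJOB (V vX))) ;;
  For vX (V vM) (Put 0 (Plus (V vN) (V vX)) (A vMULT (V vX))).

Definition algorithm : stmt :=
  init_costs ;; init_peak ;; main_loop ;; take_all ;; reverse_delete ;; write_output.

Section Thinning.

Variable I : instance.

Notation n := (njobs I).
Notation m := (nresources I).
Notation N := (input_size I).
Implicit Types (i : 'I_(nresources I)) (j : 'I_(njobs I)).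
Implicit Types (J : {set 'I_(njobs I)}) (ord : seq 'I_(nresources I)).
Implicit Types (R : resource_multiset I).

Definition jobs_stored J (W : store) := forall j, W vJOB j = (j \in J)%:Z.

Definition mult_stored R (W : store) :=
  (forall i, W vMULT i = (R i)%:Z) /\ (forall i, W vLOAD i = capacity i * (R i)%:Z).

Definition order_stored ord (W : store) :=
  W vSIZE 0%N = size ord /\
  forall p, (p < size ord)%N -> W vORDER p = nth 0%N (map val ord) p.

Lemma order_item ord p : uniq ord -> (p < size ord)%N ->
  exists i, [/\ i \in ord, index i ord = p & nth 0%N (map val ord) p = i].
Proof.
move=> hu hp; have [i0 _] : exists i0, i0 \in ord.
  by case: ord hp {hu} => // i0 s _; exists i0; apply: mem_head.
by exists (nth i0 ord p); rewrite mem_nth // index_uniq // (nth_map i0).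
Qed.

Lemma order_le_size ord : uniq ord -> (size ord <= N)%N.
Proof.
move=> hu; apply: leq_trans (nresources_le_size I).
by have := max_card [in ord]; rewrite card_ord (card_uniqP hu).
Qed.

Lemma jobs_le_size J : (#|J| <= N)%N.
Proof. by apply: leq_trans (njobs_le_size I); have := max_card [in J]; rewrite card_ord. Qed.

Lemma triple_take_all W ord J (Q : store -> Prop) :
  input_ok I W -> order_stored ord W -> uniq ord -> W vCNT 0%N = #|J| ->
  (forall i, W vMULT i = 0) -> (forall i, W vLOAD i = 0) ->
  (forall W', same_off [:: vX; vCUR; vMULT; vT1; vLOAD; vMA; vMB; vMR; vMH] W W' ->
     mult_stored [ffun i => if i \in ord then #|J| else 0%N] W' -> Q W') ->
  triple N take_all W Q.
Proof.
move=> hin [hsz hord] hu hcnt hm0 hl0 hQ.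
have hJ := jobs_le_size J.
pose Inv x (W' : store) := forall i,
  W' vMULT i = (if (index i ord < x)%N then #|J| else 0%N)%:Z /\
  W' vLOAD i = capacity i * (if (index i ord < x)%N then #|J| else 0%N)%:Z.
apply: (@triple_for N vX _ _ W (size ord) [:: vCUR; vMULT; vT1; vLOAD; vMA; vMB; vMR;
  vMH] Inv) => //.
- exact: order_le_size.
- by move=> W' hW'; rewrite /= hW'.
- by move=> i /=; rewrite hm0 hl0 mulr0.
- move=> x W1 hx hW1 hx1 hinv; have [i [hi hix hxi]] := order_item hu hx.
  have hin1 : input_ok I W1 by apply: input_ok_off hW1 _ hin.
  apply: triple_then; apply: triple_set; rewrite //= ?hx1 //=.
  rewrite hW1 // hord // hxi; set W2 := upd _ _ _ _.
  have hcur2 : W2 vCUR 0%N = Posz i by [].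
  have hcnt2 : W2 vCNT 0%N = #|J| by rewrite -[LHS]/(W1 vCNT 0%N) hW1.
  apply: triple_then; apply: triple_put; rewrite //= ?hcur2 ?hcnt2 //=.
  set W3 := upd _ _ _ _.
  have hin3 : input_ok I W3 by [].
  have hcur3 : W3 vCUR 0%N = Posz i by [].
  have hcnt3 : W3 vCNT 0%N = #|J| by [].
  have [s3 e3] := @rcap_ok I W3 vCUR i hin3 hcur3 isT.
  apply: triple_then; apply: triple_mul => //=.
    by rewrite hcnt3 nat_lt_size.
  rewrite e3 hcnt3 => W4 hW4 hm4.
  have hcur4 : W4 vCUR 0%N = Posz i by rewrite hW4.
  apply: triple_put; rewrite //= ?hcur4 //= hm4; split.
    apply: same_off_upd => //; apply: (@same_off_trans _ _ W3); first by repeat apply: same_off_upd.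
    by apply: same_off_sub hW4; apply/allP.
  move=> i' /=; rewrite hW4 //; case: (i' =P i :> nat) => [/val_inj ->|hne].
    by rewrite hix ltnSn /W3 /= eqxx.
  have -> : (index i' ord < x.+1)%N = (index i' ord < x)%N.
    rewrite ltnS leq_eqVlt; case: eqP => //= E; exfalso; apply: hne; congr val.
    have hi' : i' \in ord by rewrite -index_mem E.
    by rewrite -(nth_index i hi') E -hix nth_index.
  have [h1 h2] := hinv i'; rewrite hW4 // /W3 /= (introF eqP hne); split => //.
- move=> W1 hW1 hinv; apply: hQ => //.
  by split => i; rewrite ffunE -index_mem; have [] := hinv i.
Qed.

Lemma job_profileE J t :
  (job_profile J t)%:Z = \sum_(j | job_active j t) (j \in J)%:Z.
Proof.
rewrite /job_profile -sum1_card (big_morph Posz PoszD (erefl _)).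
rewrite big_mkcond [RHS]big_mkcond; apply: eq_bigr => j _; rewrite inE.
by case: (j \in J); case: (job_active j t).
Qed.

Lemma triple_check_time W J R (t : nat) (Q : store -> Prop) :
  input_ok I W -> W vT 0%N = t -> jobs_stored J W -> mult_stored R W ->
  (forall W', same_off [:: vD; vY; vBAD] W W' ->
     W' vBAD 0%N = (if res_profile R t < (job_profile J t)%:Z then 1 else W vBAD 0%N) ->
     Q W') -> triple N check_time W Q.
Proof.
move=> hin ht hj [_ hl] hQ.
apply: triple_then; apply: triple_set => //=; apply: triple_then.
set W1 := upd _ _ _ _.
apply: (@triple_for N vY _ _ W1 m [:: vD] (fun x W' => W' vD 0%N =
   \sum_(i : 'I_m | (i < x)%N && res_active i t) capacity i * (R i)%:Z)) => //.
- exact: nresources_le_size.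
- exact: bound_m.
- by rewrite big_pred0_eq.
- move=> x W2 hx hW2 hx2 hinv; pose i := Ordinal hx.
  have hin2 : input_ok I W2 by apply: input_ok_off hW2 _ hin.
  have [s1 e1] := @rstart_ok I W2 vY i hin2 hx2 isT.
  have [s2 e2] := @rend_ok I W2 vY i hin2 hx2 isT.
  have hl2 : W2 vLOAD x = capacity i * (R i)%:Z by rewrite hW2 //; apply: (hl i).
  apply: (@triple_active _ _ _ _ _ _ (res_start i) (res_end i) t) => //; first by rewrite hW2.
    move=> ha; apply: triple_set; rewrite //= ?hx2 //= hl2 hinv; split; first exact: same_off_upd.
    by rewrite /= (sum_upto _ _ hx) -/i ifT.
  move=> ha; split => //=; rewrite hinv (sum_upto _ _ hx) -/i ifF ?addr0 //.
  exact: negbTE.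
move=> W2 hW2 hD2.
have hoff2 : same_off [:: vD; vY; vBAD] W W2.
  by apply: (@same_off_trans _ _ W1); [apply: same_off_upd|apply: same_off_sub hW2; apply/allP].
have {}hD2 : W2 vD 0%N = res_profile R t.
  rewrite hD2 /res_profile; apply: eq_big => i; first by rewrite ltn_ord.
  by rewrite intmulnE.
have hin2 : input_ok I W2 by apply: input_ok_off hW2 _ hin.
apply: triple_then.
apply: (@triple_for N vY _ _ W2 n [:: vD] (fun x W' => W' vD 0%N = res_profile R t -
   \sum_(j : 'I_n | (j < x)%N && job_active j t) (j \in J)%:Z)) => //.
- exact: njobs_le_size.
- exact: bound_n.
- by rewrite big_pred0_eq subr0.
- move=> x W3 hx hW3 hx3 hinv; pose j := Ordinal hx.
  have hin3 : input_ok I W3 by apply: input_ok_off hW3 _ hin2.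
  have [s1 e1] := @jstart_ok I W3 vY j hin3 hx3 isT.
  have [s2 e2] := @jend_ok I W3 vY j hin3 hx3 isT.
  have hj3 : W3 vJOB x = (j \in J)%:Z by rewrite hW3 // hoff2 //; apply: (hj j).
  apply: (@triple_active _ _ _ _ _ _ (job_start j) (job_end j) t) => //.
  - by rewrite hW3 // hoff2.
  - move=> ha; apply: triple_set; rewrite //= ?hx3 //= hj3 hinv; split; first exact: same_off_upd.
    by rewrite /= (sum_upto _ _ hx) -/j ifT // opprD addrA.
  move=> ha; split => //=; rewrite hinv (sum_upto _ _ hx) -/j ifF ?addr0 //.
  exact: negbTE.
move=> W3 hW3 hD3.
have {}hD3 : W3 vD 0%N = res_profile R t - (job_profile J t)%:Z.
  by rewrite hD3 job_profileE; congr (_ - _); apply: eq_bigl => j; rewrite ltn_ord.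
have hoff3 : same_off [:: vD; vY; vBAD] W W3.
  by apply: same_off_trans hoff2 _; apply: same_off_sub hW3; apply/allP.
have hbad3 : W3 vBAD 0%N = W vBAD 0%N by rewrite hW3 // hW2.
apply: triple_if => //=; rewrite hD3 => hcmp.
  apply: triple_set => //; apply: hQ; first exact: same_off_upd.
  by rewrite /= ifT //; lia.
by apply: triple_nop; apply: hQ => //; rewrite ifF //; lia.
Qed.

Lemma triple_check W J R (Q : store -> Prop) :
  input_ok I W -> jobs_stored J W -> mult_stored R W ->
  (forall i, (0 < R i)%N -> 0 <= capacity i) ->
  (forall W', same_off [:: vBAD; vX; vT; vD; vY] W W' ->
     (W' vBAD 0%N = 0 /\ forall t, (job_profile J t)%:Z <= res_profile R t) \/
     (W' vBAD 0%N = 1 /\ exists t, res_profile R t < (job_profile J t)%:Z) -> Q W') ->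
  triple N check W Q.
Proof.
move=> hin hj hm hc hQ.
pose bad (P : nat -> Prop) (W' : store) :=
  (W' vBAD 0%N = 0 /\ forall t, P t -> (job_profile J t)%:Z <= res_profile R t) \/
  (W' vBAD 0%N = 1 /\ exists t, res_profile R t < (job_profile J t)%:Z).
have step W1 (P P' : nat -> Prop) (t : nat) (Q' : store -> Prop) :
    input_ok I W1 -> jobs_stored J W1 -> mult_stored R W1 -> W1 vT 0%N = t ->
    bad P W1 -> (forall t', P' t' -> P t' \/ t' = t) ->
    (forall W', same_off [:: vD; vY; vBAD] W1 W' -> bad P' W' -> Q' W') ->
    triple N check_time W1 Q'.
  move=> h1 h2 h3 h4 h5 h6 h7; apply: (@triple_check_time _ J R t) => // W2 h8 h9; apply: h7 => //.
  move: h9; case: ltP => h9 h10; first by right; split => //; exists t.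
  case: h5 => [[h11 h12]|[h11 h12]]; [left|right]; rewrite h10; split => // t' /h6[/h12|->] //.
apply: triple_then; apply: triple_set => //=; apply: triple_then; set W1 := upd _ _ _ _.
apply: (@triple_for N vX _ _ W1 n [:: vT; vD; vY; vBAD]
  (fun x W' => bad (fun t => exists2 j : 'I_n, (j < x)%N & t = job_start j) W')) => //.
- exact: njobs_le_size.
- exact: bound_n.
- by left; split => // t [].
- move=> x W2 hx hW2 hx2 hinv; pose j := Ordinal hx.
  have hin2 : input_ok I W2 by apply: input_ok_off hW2 _ hin.
  have [s1 e1] := @jstart_ok I W2 vX j hin2 hx2 isT.
  apply: triple_then; apply: triple_set; rewrite //= e1.
  apply: (step _ (fun t => exists2 j : 'I_n, (j < x)%N & t = job_start j)
     (fun t => exists2 j : 'I_n, (j < x.+1)%N & t = job_start j) (job_start j)) => //.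
  + by move=> j' /=; rewrite hW2 //; apply: hj.
  + by case: hm => hm1 hm2; split => i /=; rewrite hW2 //; [apply: hm1|apply: hm2].
  + move=> t [j' hj' ->]; case: (ltnP j' x) => h; first by left; exists j'.
    by right; congr (job_start _); apply: val_inj => /=; lia.
  + move=> W3 hW3 hb3; split => //; apply: (@same_off_trans _ _ (upd W2 vT 0%N (job_start j))).
      exact: same_off_upd.
    by apply: same_off_sub hW3; apply/allP.
move=> W2 hW2 hb2.
have hoff2 : same_off [:: vBAD; vX; vT; vD; vY] W W2.
  by apply: (@same_off_trans _ _ W1); [apply: same_off_upd|apply: same_off_sub hW2; apply/allP].
have hin2 : input_ok I W2 by apply: input_ok_off hW2 _ hin.
apply: (@triple_for N vX _ _ W2 m [:: vT; vD; vY; vBAD]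
  (fun x W' => bad (fun t => (exists2 j : 'I_n, (j < n)%N & t = job_start j) \/
     exists2 i : 'I_m, (i < x)%N & t = (res_end i).+1) W')) => //.
- exact: nresources_le_size.
- exact: bound_m.
- case: hb2 => [[h1 h2]|h]; [left|by right]; split => // t [|[]//]; exact: h2.
- move=> x W3 hx hW3 hx3 hinv; pose i := Ordinal hx.
  have hin3 : input_ok I W3 by apply: input_ok_off hW3 _ hin2.
  have [s1 e1] := @rend_ok I W3 vX i hin3 hx3 isT.
  apply: triple_then; apply: triple_set; rewrite /= ?s1 // e1.
  have hoff3 : same_off [:: vBAD; vX; vT; vD; vY] W W3.
    by apply: same_off_trans hoff2 _; apply: same_off_sub hW3; apply/allP.
  apply: (step _ (fun t => (exists2 j : 'I_n, (j < n)%N & t = job_start j) \/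
     exists2 i : 'I_m, (i < x)%N & t = (res_end i).+1)
     (fun t => (exists2 j : 'I_n, (j < n)%N & t = job_start j) \/
     exists2 i : 'I_m, (i < x.+1)%N & t = (res_end i).+1) (res_end i).+1) => //.
  + by move=> j' /=; rewrite hoff3 //; apply: hj.
  + by case: hm => hm1 hm2; split => i' /=; rewrite hoff3 ?hm1 ?hm2.
  + by rewrite /=; lia.
  + move=> t [h|[i' hi' ->]]; first by left; left.
    case: (ltnP i' x) => h; first by left; right; exists i'.
    by right; congr (res_end _).+1; apply: val_inj => /=; lia.
  + move=> W4 hW4 hb4; split => //.
    apply: (@same_off_trans _ _ (upd W3 vT 0%N ((res_end i)%:Z + 1))).
      exact: same_off_upd.
    by apply: same_off_sub hW4; apply/allP.
move=> W3 hW3 hb3; apply: hQ.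
  by apply: same_off_trans hoff2 _; apply: same_off_sub hW3; apply/allP.
case: hb3 => [[h1 h2]|h]; [left|by right]; split => //.
apply: covers_breakpoints => // [j|i]; apply: h2; [left|right]; last by exists i.
by exists j.
Qed.

Lemma triple_attempt W J R i (Q : store -> Prop) :
  input_ok I W -> jobs_stored J W -> mult_stored R W -> W vCUR 0%N = Posz i ->
  (forall i, (0 < R i)%N -> 0 <= capacity i) -> (0 < R i)%N ->
  (forall W', same_off [:: vMULT; vLOAD; vBAD; vX; vT; vD; vY] W W' ->
     (mult_stored (decr R i) W' /\
        forall t, (job_profile J t)%:Z <= res_profile (decr R i) t) \/
     (mult_stored R W' /\ exists t, res_profile (decr R i) t < (job_profile J t)%:Z) ->
     Q W') -> triple N attempt W Q.
Proof.
move=> hin hj [hm1 hm2] hcur hc hR hQ.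
apply: triple_then; apply: triple_put; rewrite //= ?hcur //= (hm1 i).
set W1 := upd _ _ _ _.
have hcur1 : W1 vCUR 0%N = Posz i by [].
have [s1 e1] := @rcap_ok I W1 vCUR i hin hcur1 isT.
have hl1 : W1 vLOAD i = capacity i * (R i)%:Z by apply: hm2.
apply: triple_then; apply: triple_put; rewrite //= ?hcur1 //= ?s1 // e1 hl1.
set W2 := upd _ _ _ _.
have hm2' : mult_stored (decr R i) W2.
  split => i'; rewrite /W2 /W1 /= ffunE; case: (i' =P i :> nat) => [/val_inj ->|hne].
  - by rewrite eqxx; lia.
  - by rewrite (introF eqP (_ : i' <> i)) ?hm1 // => E; apply: hne; rewrite E.
  - by rewrite eqxx -[R i in LHS]prednK // -[_.+1]addn1 PoszD; ring.
  - by rewrite (introF eqP (_ : i' <> i)) ?hm2 // => E; apply: hne; rewrite E.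
apply: triple_then; apply: (@triple_check _ J (decr R i)) => //.
  move=> i'; rewrite ffunE => h; apply: hc; move: h; case: eqP => // _; lia.
move=> W3 hW3 hb3.
have hoff2 : same_off [:: vMULT; vLOAD; vBAD; vX; vT; vD; vY] W W2.
  by repeat apply: same_off_upd.
have hoff3 : same_off [:: vMULT; vLOAD; vBAD; vX; vT; vD; vY] W W3.
  by apply: same_off_trans hoff2 _; apply: same_off_sub hW3; apply/allP.
have hm3 : mult_stored (decr R i) W3.
  by case: hm2' => h1 h2; split => i'; rewrite hW3.
have hin3 : input_ok I W3 by apply: input_ok_off hoff3 _ hin.
have hcur3 : W3 vCUR 0%N = Posz i by rewrite hoff3.
apply: triple_if => //=; case: hb3 => [[hb h]|[hb h]]; rewrite hb //= => _; last first.
  by apply: triple_nop; apply: hQ => //; left.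
have [hm31 hm32] := hm3.
apply: triple_then; apply: triple_put; rewrite //= ?hcur3 //= (hm31 i).
set W4 := upd _ _ _ _.
have hcur4 : W4 vCUR 0%N = Posz i by [].
have [s4 e4] := @rcap_ok I W4 vCUR i hin3 hcur4 isT.
have hl4 : W4 vLOAD i = capacity i * (decr R i i)%:Z by apply: hm32.
apply: triple_put; rewrite //= ?hcur4 //= ?s4 // e4 hl4.
have hdi : decr R i i = (R i).-1 by rewrite ffunE eqxx.
apply: hQ; first by repeat apply: same_off_upd.
right; split => //; split => i'; rewrite /W4 /= hdi; case: (i' =P i :> nat) => [/val_inj ->|hne].
- by lia.
- by rewrite hm31 ffunE (introF eqP (_ : i' <> i)) // => E; apply: hne; rewrite E.
- by rewrite -[R i in RHS]prednK // -[_.+1]addn1 PoszD; ring.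
- by rewrite hm32 ffunE (introF eqP (_ : i' <> i)) // => E; apply: hne; rewrite E.
Qed.

Lemma triple_reverse_delete W ord J R (Q : store -> Prop) :
  input_ok I W -> order_stored ord W -> uniq ord ->
  (forall i, i \in ord -> 0 < capacity i) -> W vCNT 0%N = #|J| ->
  jobs_stored J W -> mult_stored R W -> delete_ok ord J (size ord) R ->
  (forall W' R', same_off [:: vU; vCUR; vZ; vMULT; vLOAD; vBAD; vX; vT; vD; vY] W W' ->
     mult_stored R' W' -> delete_ok ord J 0 R' -> Q W') ->
  triple N reverse_delete W Q.
Proof.
move=> hin [hsz hord] hu hcap hcnt hj hm hdel hQ.
have hJ := jobs_le_size J.
apply: (@triple_for N vU _ _ W (size ord) [:: vCUR; vZ; vMULT; vLOAD; vBAD; vX; vT; vD; vY]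
  (fun u W' => exists R', mult_stored R' W' /\ delete_ok ord J (size ord - u) R')) => //.
- exact: order_le_size.
- by move=> W' hW'; rewrite /= hW'.
- by exists R; rewrite subn0.
- move=> u W1 hlt hW1 hu1 [R1 [hm1 hd1]].
  have hq : (size ord - u.+1 < size ord)%N by lia.
  have [i [hi hiq hval]] := order_item hu hq.
  have hin1 : input_ok I W1 by apply: input_ok_off hW1 _ hin.
  have hsz1 : W1 vSIZE 0%N = size ord by rewrite hW1.
  have hidx : W1 vSIZE 0%N - 1 - W1 vU 0%N = Posz (size ord - u.+1) by rewrite hsz1 hu1; lia.
  have hord1 : W1 vORDER (size ord - u.+1)%N = Posz i by rewrite hW1 // hord // hval.
  apply: triple_then; apply: triple_set; rewrite //= ?hidx //= hord1.
  set W2 := upd _ _ _ _.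
  have hoff2 : same_off [:: vU; vCUR; vZ; vMULT; vLOAD; vBAD; vX; vT; vD; vY] W W2.
    by apply: same_off_upd => //; apply: same_off_sub hW1; apply/allP.
  pose q := (size ord - u.+1)%N.
  have hdel1 : deleting ord J q R1.
    by apply: deleting_start; move: hd1; rewrite /q;
      have -> : (size ord - u = (size ord - u.+1).+1)%N by lia.
  (* After [a] attempts, either all have succeeded, or one has failed and the resource is critical
     with a copy left. In both cases a copy is available for the next attempt. *)
  pose Inv a (W' : store) := exists R', [/\ mult_stored R' W', deleting ord J q R' &
    R' i = (#|J| - a)%N \/ ((0 < R' i)%N /\ critical ord R' J i)].
  apply: (@triple_for N vZ _ _ W2 #|J| [:: vMULT; vLOAD; vBAD; vX; vT; vD; vY] Inv) => //.
  + by move=> W' hW'; rewrite /= hW' // -[W2 vCNT 0%N]/(W1 vCNT 0%N) hW1.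
  + exists R1; split => //; left; rewrite subn0.
    by apply: (delete_full hd1); rewrite hiq; lia.
  + move=> a W3 ha hW3 ha3 [R3 [hm3 hd3 hprog]].
    have hin3 : input_ok I W3 by apply: input_ok_off hW3 _ hin1.
    have hj3 : jobs_stored J W3 by move=> j; rewrite hW3 // hoff2.
    have hcur3 : W3 vCUR 0%N = Posz i by rewrite hW3.
    have hR3 : (0 < R3 i)%N by case: hprog => [->|[]//]; lia.
    apply: (@triple_attempt _ J R3 i) => //.
      move=> i' hi'; have : i' \in ord.
        by apply: contraLR hi' => /(deleting_support hd3) ->.
      by move/hcap/ltW.
    move=> W4 hW4 [[hm4 hc4]|[hm4 [t hbad]]]; split => //.
    * exists (decr R3 i); split => //; first exact: deleting_succeed.
      (* A success after a failure is impossible: at the critical time one copy less does not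
         suffice. *)
      left; case: hprog => [h|[_ [t [h1 h2 _]]]]; first by rewrite ffunE eqxx h; lia.
      by have := hc4 t; rewrite decr_profile // h1 mulr1n; lia.
    * exists R3; split => //; right; split => //.
      exact: (@deleting_fail _ _ _ q _ _ t).
  + move=> W3 hW3 [R3 [hm3 hd3 hprog]]; split.
      apply: (@same_off_trans _ _ W2); first exact: same_off_upd.
      by apply: same_off_sub hW3; apply/allP.
    exists R3; split => //; apply: deleting_stop => // i' hi' hR'.
    have hi'o : i' \in ord by apply: contraLR hR' => /(deleting_support hd3) ->.
    have E : i' = i by rewrite -(nth_index i hi'o) hi' /q -hiq nth_index.
    rewrite E in hR' *; case: hprog => [h|[]//]; by rewrite h subnn in hR'.
- by move=> W1 hW1 [R1 [hm1 hd1]]; apply: (hQ _ R1) => //; rewrite subnn in hd1.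
Qed.

Lemma triple_write_output W J R (Q : store -> Prop) :
  input_ok I W -> jobs_stored J W -> mult_stored R W ->
  (forall W' : store, (forall j, W' 0%N j = (j \in J)%:Z) ->
     (forall i, W' 0%N (n + i)%N = (R i)%:Z) -> Q W') ->
  triple N write_output W Q.
Proof.
move=> hin hj [hm _] hQ.
have [_ hn0 hm0] := encode_head I.
apply: triple_then; apply: triple_set => //=; rewrite hin hn0.
apply: triple_then; apply: triple_set => //=; rewrite hin hm0.
set W1 := upd _ _ _ _; apply: triple_then.
apply: (@triple_for N vX _ _ W1 n [:: 0%N]
  (fun x W' => forall j, (j < x)%N -> W' 0%N j = (j \in J)%:Z)) => //.
- exact: njobs_le_size.
- by move=> W' hW'; rewrite /= hW'.
- move=> x W2 hx hW2 hx2 hinv; apply: triple_put; rewrite //= ?hx2 //=; split.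
    exact: same_off_upd.
  move=> j hjx /=; case: eqP => [E|hne].
    by rewrite hW2 //= -E; apply: hj.
  by apply: hinv; lia.
move=> W2 hW2 hj2.
apply: (@triple_for N vX _ _ W2 m [:: 0%N]
  (fun x W' => (forall j, W' 0%N j = (j \in J)%:Z) /\
     forall i, (i < x)%N -> W' 0%N (n + i)%N = (R i)%:Z)) => //.
- exact: nresources_le_size.
- by move=> W' hW'; rewrite /= hW' //= hW2.
- by split => // j; apply: hj2.
- move=> x W3 hx hW3 hx3 [hj3 hm3].
  have hN3 : W3 vN 0%N = n by rewrite hW3 // hW2.
  have hM3 : W3 vMULT x = W vMULT x by rewrite hW3 // hW2.
  apply: triple_put; rewrite //= ?hx3 ?hN3 //=; split; first exact: same_off_upd.
  rewrite hM3; split => [j|i hi] /=.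
    by have -> : (j == n + x :> nat)%N = false by have := ltn_ord j; lia.
  rewrite eqn_add2l; case: eqP => [E|hne]; first by rewrite -E.
  by apply: hm3; lia.
- by move=> W3 hW3 [h1 h2]; apply: hQ => // i; apply: h2.
Qed.

(** * The whole algorithm *)

Definition initial_store : store :=
  fun c p => if c == 0%N then nth 0 (encode I) p else 0.

Lemma initial_memoryE : initial_memory I = mem initial_store.
Proof. by apply: functional_extensionality => -[p|p]. Qed.

Lemma common_denominator i :
  res_cost i = (numq (res_cost i) * \prod_(i' | i' != i) denq (res_cost i'))%:~R
               / (\prod_(i' : 'I_m) denq (res_cost i'))%:~R.
Proof.
rewrite [X in _ / X%:~R](bigD1 i) //= !rmorphM /=.
have h : (\prod_(i' | i' != i) denq (res_cost i'))%:~R != 0 :> rat.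
  by rewrite intr_eq0; apply/prodf_neq0 => i' _; rewrite denq_neq0.
by rewrite -mulf_div divff // mulr1 divq_num_den.
Qed.

(** Feasibility is a premise inside the postcondition, because halting within the time bound is
    required on infeasible instances as well. *)
Lemma triple_algorithm : single_mountain I ->
  triple N algorithm initial_store (fun W' =>
    (exists (R : resource_multiset I) (J : {set 'I_n}), feasible R J) ->
    exists (R : resource_multiset I) (J : {set 'I_n}),
      [/\ outputs (mem W') R J, feasible R J
        & forall (R' : resource_multiset I) (J' : {set 'I_n}),
            feasible R' J' -> multiset_cost R <= 8%:R * multiset_cost R']).
Proof.
move=> hmt.
have hin0 : input_ok I initial_store by [].
apply: triple_then; apply: triple_init_costs => // W1 hW1 hcost1.
have hin1 : input_ok I W1 by apply: input_ok_off hW1 _ hin0.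
apply: triple_then; apply: triple_init_peak => // W2 t0 hW2 hl2 hr2 peak.
have hin2 : input_ok I W2 by apply: input_ok_off hW2 _ hin1.
pose cur0 i := numq (res_cost i) * \prod_(i' | i' != i) denq (res_cost i').
have hst2 : stores [::] t0 t0 set0 cur0 W2.
  split; rewrite ?cards0 //.
  - by rewrite hW2 // hW1.
  - by rewrite hW2 // hW1.
  - by move=> i; rewrite hW2 // hcost1.
  - by move=> j; rewrite inE hW2 // hW1.
have hok2 : state_ok t0 [::] t0 t0 set0 cur0.
  apply: (@state_init _ _ _ (\prod_(i' : 'I_m) denq (res_cost i'))%:~R);
    last exact: common_denominator.
  by rewrite ltr0z; apply: prodr_gt0 => i' _; apply: denq_gt0.
apply: triple_then; apply: (triple_main_loop hin2 hst2 hok2).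
move=> W3 ord l r J cur hW3 [_ hc3 ho3 _ hj3] hok3 hstuck.
have hin3 : input_ok I W3 by apply: input_ok_off hW3 _ hin2.
apply: triple_then; apply: (@triple_take_all _ ord J) => //.
- exact: order_uniq hok3.
- by move=> i; rewrite hW3 // hW2 // hW1.
- by move=> i; rewrite hW3 // hW2 // hW1.
move=> W4 hW4 hm4.
have hin4 : input_ok I W4 by apply: input_ok_off hW4 _ hin3.
apply: triple_then; apply: (@triple_reverse_delete _ ord J _) hm4 _ _ => //.
- by case: ho3 => h1 h2; split => [|p hp]; rewrite hW4 //; apply: h2.
- exact: order_uniq hok3.
- exact: order_capacity hok3.
- by rewrite hW4.
- by move=> j; rewrite hW4.
- exact: delete_init hok3.
move=> W5 R hW5 hm5 hd5.
have hin5 : input_ok I W5 by apply: input_ok_off hW5 _ hin4.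
apply: (@triple_write_output _ J R) => //.
  by move=> j; rewrite hW5 // hW4.
move=> W6 hJ6 hR6 [R0 [J0 hf]]; exists R, J; split.
- by split => [j|i]; [apply: hJ6|apply: hR6].
- split; last by move=> t _; apply: (delete_cover hd5).
  (* Too few chosen jobs would mean that the scan ended stuck, which the given feasible solution
     excludes. *)
  rewrite leNgt; apply/negP => hlt.
  exact: (stuck_infeasible peak hok3 hlt (hstuck hlt) hf).
- exact: (approximation_bound peak hok3 hd5).
Qed.

End Thinning.

Theorem theorem3 :
  exists prog : cmd, approximation_algorithm single_mountain 8%:R%R prog.
Proof.
exists (compile algorithm); split.
- exists (coefficient algorithm), (degree algorithm) => I hI.
  have [W' [t [h1 h2 _]]] := triple_algorithm hI.
  exists (mem W'), t; rewrite initial_memoryE; split => //.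
  apply: leq_trans h2 _; apply: time_polynomial; have := input_size_ge I; lia.
- move=> I hI hf; have [W' [t [h1 _ h3]]] := triple_algorithm hI.
  have [R [J [h4 h5 h6]]] := h3 hf.
  by exists (mem W'), t, R, J; rewrite initial_memoryE.
Qed.
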